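(* Let $n,m,d$ be positive integers with $n\ge d(m-1)+1$, and assume that $n$ players are $(m,d)$-hungry. Then there exist a partition of the $d$ cakes into $m$ interval pieces each, and an allocation of $d$-tuples of pieces to a subset $S$ of players with $|S|\ge\frac{m}{d-1}$ (distinct players in $S$ receiving $d$-tuples with no piece in common), such that each player in $S$ receives one of their favorite $d$-tuples of pieces in that partition.
   Context: There are $d$ cakes, each identified with a copy of $[0,1]$. A partition of the cakes into $m$ interval pieces each consists of, for each cake, cut points $0\le c_1\le\dots\le c_{m-1}\le 1$ giving $m$ (possibly empty) consecutive interval pieces. A $d$-tuple of pieces consists of one piece from each cake. For every such partition, each player chooses (prefers) some $d$-tuples of pieces. The $n$ players are called $(m,d)$-hungry if: (1) for any partition of the $d$ cakes into $m$ interval pieces each and any set $I$ of $n-d(m-1)$ players, some player in $I$ prefers a $d$-tuple consisting of non-empty pieces; and (2) preference sets are closed: if a player prefers a given $d$-tuple (indexed by positions of pieces) in each partition of a converging sequence of partitions, they prefer the same $d$-tuple in the limit partition.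
   Formalization: The number d of cakes is assumed to be at least 2, since for d = 1 the bound m/(d−1) in the statement divides by zero and is undefined. *)

(* Defs.v *)
From mathcomp Require Import all_boot.
From Stdlib Require Import Reals.
Set Implicit Arguments. Unset Strict Implicit. Unset Printing Implicit Defensive.

(* A partition of the d cakes into m interval pieces each is encoded by
   P : 'I_d -> 'I_m.+1 -> R, where P k j is the j-th cut point of cake k
   (P k 0 = 0, P k m = 1, nondecreasing). Piece j : 'I_m of cake k is the
   interval [P k j, P k (j+1)]. *)
Definition cake_partition (d m : nat) := 'I_d -> 'I_m.+1 -> R.

Definition dtuple (d m : nat) := 'I_d -> 'I_m.

Definition valid_partition (d m : nat) (P : cake_partition d m) : Prop :=
  forall k : 'I_d,
    P k ord0 = 0%R /\ P k ord_max = 1%R /\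
    (forall j j' : 'I_m.+1, (j <= j')%N -> (P k j <= P k j')%R).

Definition piece_nonempty (d m : nat) (P : cake_partition d m) (k : 'I_d) (j : 'I_m) : Prop :=
  (P k (inord j) < P k (inord j.+1))%R.

Definition tuple_nonempty (d m : nat) (P : cake_partition d m) (t : dtuple d m) : Prop :=
  forall k : 'I_d, piece_nonempty P k (t k).

Definition preferences (n d m : nat) := 'I_n -> cake_partition d m -> dtuple d m -> Prop.

Definition partition_cvg (d m : nat) (Ps : nat -> cake_partition d m) (P : cake_partition d m) : Prop :=
  forall (k : 'I_d) (j : 'I_m.+1), Un_cv (fun t => Ps t k j) (P k j).

Definition hungry (n m d : nat) (pref : preferences n d m) : Prop :=
  (forall (P : cake_partition d m) (I : {set 'I_n}),
      valid_partition P -> #|I| = (n - d * (m - 1))%N ->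
      exists i, i \in I /\ exists t, pref i P t /\ tuple_nonempty P t) /\
  (forall (i : 'I_n) (Ps : nat -> cake_partition d m) (P : cake_partition d m) (t : dtuple d m),
      (forall s, valid_partition (Ps s)) -> partition_cvg Ps P ->
      (forall s, pref i (Ps s) t) -> pref i P t).

(* Main.v *)
Require Import Defs.
From mathcomp Require Import all_boot all_order all_algebra.
From mathcomp Require Import boolp ring lra zify.

(** Put D = d(m-1). Partitions are parametrised by the cube [0,1]^D: the cut points of a cake are
the running maxima of its m-1 coordinates, so a coordinate 0 makes one piece empty and a coordinate 1
makes all later pieces of that cake empty. Label a preferred tuple t of non-empty pieces by the vector
with entries [t_k > i] - (m-1-i) [t_k = i]. These labels satisfy the sign conditions of the
Poincare-Miranda theorem, and 0 is a convex combination of labels exactly when the corresponding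
weights load every piece equally.

The topological core is a rainbow version of Poincare-Miranda on the grid {0..N}^D, where every grid
point has at least D+1 hungry players. Over a grid cube the simplices whose vertices are pairs (grid point,
player hungry there) with distinct players form a join of at least D+1 non-empty discrete sets,
which is acyclic in dimensions < D. Hence the cubical chain complex maps to the complex of rainbow simplices,
and a mod 2 degree count along a flag of faces of the cube yields a rainbow simplex, all of whose
grid points lie in one cube, with 0 in the convex hull of its labels (up to a small error).

Scaling the weights gives a fractional matching of size almost m in a d-partite hypergraph. Furedi's
argument turns it into a matching of size at least m/(d-1), whose edges belong to distinct players.
Compactness as N grows finishes the proof. *)

(** * Linear algebra *)

Section LinAlg.
Set Implicit Arguments. Unset Strict Implicit.
Import Order.TTheory GRing.Theory Num.Theory.
Local Open Scope ring_scope.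

Lemma linear_dependency (F : fieldType) (E V : finType) (S : {set E}) (T : {set V})
    (M : V -> E -> F) :
  (#|T| < #|S|)%N ->
  exists z : E -> F, [/\ forall e, e \notin S -> z e = 0, exists e, z e != 0 &
    forall v, v \in T -> \sum_e M v e * z e = 0].
Proof.
move=> ltTS.
pose A := \matrix_(i < #|S|, j < #|T|) M (enum_val j) (enum_val i).
have kerN0 : kermx A != 0.
  rewrite kermx_eq0 /row_free neq_ltn; apply/orP; left.
  exact: leq_ltn_trans (rank_leq_col A) ltTS.
have [u uA uN0] := rowV0Pn kerN0.
have [i ui] : exists i, u 0 i != 0.
  apply/existsP; apply: contraNT uN0 => /existsPn u0.
  by apply/eqP/rowP => i; rewrite mxE; apply/eqP/negPn.
pose z e := \sum_(j < #|S| | enum_val j == e) u 0 j.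
have zE (j : 'I_#|S|) : z (enum_val j) = u 0 j.
  by rewrite /z (big_pred1 j) // => j'; rewrite (inj_eq enum_val_inj).
have z0 e : e \notin S -> z e = 0.
  move=> eS; rewrite /z big_pred0 // => j.
  by apply: contraNF eS => /eqP <-; apply: enum_valP.
exists z; split=> //; first by exists (enum_val i); rewrite zE.
move=> v vT; rewrite (bigID (mem S)) /= [X in _ + X]big1 ?addr0; last first.
  by move=> e /z0->; rewrite mulr0.
rewrite big_enum_val /=.
have /sub_kermxP/rowP/(_ (enum_rank_in vT v)) := uA.
rewrite !mxE => uA0; apply: etrans uA0; apply: eq_bigr => j _.
by rewrite zE mxE enum_rankK_in // mulrC.
Qed.

(** The step length is the least ratio [alpha c / - beta c] over the decreasing coordinates, as in
    the simplex method. The second hypothesis makes these [alpha c] positive, hence [0 < t]. *)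
Lemma ratio_test (F : realFieldType) (X : finType) (alpha beta : X -> F) :
  (forall c, 0 <= alpha c) -> (forall c, alpha c = 0 -> 0 <= beta c) ->
  (exists c, beta c < 0) ->
  exists t, [/\ 0 < t, forall c, 0 <= alpha c + t * beta c &
    exists c, beta c < 0 /\ alpha c + t * beta c = 0].
Proof.
move=> a0 ab0 [c0 bc0].
pose f c := alpha c / - beta c.
case: (@Order.TotalTheory.arg_minP _ _ _ c0 (fun c => beta c < 0) f bc0) => c bc fmin.
have ac : 0 < alpha c.
  rewrite lt_def a0 andbT; apply/eqP => /ab0; rewrite leNgt bc //.
have fc : f c * beta c = - alpha c.
  by rewrite /f invrN mulrN mulNr divfK // lt_eqF.
exists (f c); split.
- by rewrite divr_gt0 // oppr_gt0.
- move=> c'; have [b0|b0] := leP 0 (beta c').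
    by rewrite addr_ge0 // mulr_ge0 // divr_ge0 // oppr_ge0 ltW.
  have := fmin c' b0; rewrite {2}/f ler_pdivlMr ?oppr_gt0 //.
  by rewrite mulrN lerNl -subr_ge0 opprK addrC.
- by exists c; rewrite fc subrr.
Qed.
End LinAlg.

(** * Cones of nonnegative relations among vectors in general position *)

Section Pivot.
Set Implicit Arguments. Unset Strict Implicit.
Import Order.TTheory GRing.Theory Num.Theory.
Local Open Scope ring_scope.
Lemma card_setD1 (T : finType) (s : {set T}) w k : w \in s -> #|s| = k.+1 -> #|s :\ w| = k.
Proof. by move=> ws; rewrite (cardsD1 w) ws => -[]. Qed.

Variables (F : realFieldType) (W : finType) (a : W -> nat -> F).

Definition supported (s : {set W}) (l : W -> F) := forall w, w \notin s -> l w = 0.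
Definition kills q (l : W -> F) := forall p, (p < q)%N -> \sum_w l w * a w p = 0.
(** General position, imposed on the truncations to every initial segment of coordinates because the
    degree count lowers the dimension one coordinate at a time. *)
Definition generic D := forall q (s : {set W}) l, (q <= D)%N -> #|s| = q ->
  supported s l -> kills q l -> forall w, l w = 0.
Definition conic (s : {set W}) q (l : W -> F) :=
  [/\ forall w, 0 <= l w, supported s l, exists w, l w != 0 & kills q l].
Definition origin_in_hull q (s : {set W}) := `[< exists l, conic s q l >].
Definition meets_ray q (s : {set W}) :=
  `[< exists2 l, conic s q l & \sum_w l w * a w q < 0 >].

Lemma killsD q t l m : kills q l -> kills q m -> kills q (fun w => l w + t * m w).
Proof.
move=> kl km p pq; under eq_bigr do rewrite mulrDl -mulrA.
by rewrite big_split -mulr_sumr /= kl // km // mulr0 addr0.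
Qed.

Lemma suppD s t l m : supported s l -> supported s m -> supported s (fun w => l w + t * m w).
Proof. by move=> sl sm w ws; rewrite sl // sm // mulr0 addr0. Qed.

Variable D : nat.
Hypothesis genD : generic D.

Section OneDim.
Variables (q : nat) (s : {set W}).
Hypotheses (qD : (q <= D)%N) (cs : #|s| = q.+2).

(** Together with [kernel_vanishing] this makes the relations on [s] a plane: two zeros leave [q]
    points, whose truncated labels are independent. *)
Lemma two_zeros_eq0 l w1 w2 : supported s l -> kills q l -> w1 \in s -> w2 \in s ->
  w1 != w2 -> l w1 = 0 -> l w2 = 0 -> forall w, l w = 0.
Proof.
move=> sl kl w1s w2s w12 l1 l2; apply: (@genD q (s :\ w1 :\ w2)) => //.
  by apply: card_setD1; [rewrite !inE eq_sym w12|apply: card_setD1].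
by move=> w; rewrite !inE !negb_and !negbK => /or3P[/eqP->|/eqP->|/sl].
Qed.

Lemma kernel_vanishing w' : w' \in s ->
  exists m, [/\ supported s m, kills q m, m w' = 0 & exists w, m w != 0].
Proof.
move=> w's.
have [|m [sm m0 km]] := @linear_dependency F W 'I_q (s :\ w') setT (fun p w => a w p).
  by rewrite cardsT card_ord (card_setD1 w's cs).
exists m; split=> //.
- by move=> w ws; apply: sm; rewrite !inE (negPf ws) andbF.
- move=> p pq; rewrite -[RHS](km (Ordinal pq) (in_setT _)).
  by apply: eq_bigr => w _; rewrite mulrC.
- by apply: sm; rewrite !inE eqxx.
Qed.

Lemma nonzero_in l w : supported s l -> l w != 0 -> w \in s.
Proof. by move=> sl; apply: contraNT => /sl->. Qed.

(** Moving along a relation that vanishes at [w0] keeps the weight at [w0] nonzero until another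
    weight reaches zero. *)
Lemma has_facet l : conic s q l -> exists m w, [/\ conic s q m, w \in s & m w = 0].
Proof.
case=> l0 sl [w0 lw0] kl; have w0s := nonzero_in sl lw0.
have [[w [ws lw]]|nz] := pselect (exists w, w \in s /\ l w = 0).
  by exists l, w; split=> //; split=> //; exists w0.
have {}nz w : w \in s -> l w != 0.
  by move=> ws; apply/eqP => lw; apply: nz; exists w.
have [m [sm km mw0 [w1 mw1]]] := kernel_vanishing w0s.
have [[w mw]|mge] := pselect (exists w, m w < 0); last first.
  exists m, w0; split=> //; split=> //; last by exists w1.
  by move=> w; rewrite leNgt; apply/negP => mw; apply: mge; exists w.
have [|t [t0 lt [w2 [mw2 lw2]]]] := ratio_test l0 _ (ex_intro _ w mw).
  move=> c /eqP lc; rewrite sm //; apply: contraTN lc; exact: nz.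
exists (fun w => l w + t * m w), w2; split=> //; last first.
  by apply: (nonzero_in sm); rewrite lt_eqF.
split=> //; [exact: suppD| |exact: killsD].
by exists w0; rewrite mw0 mulr0 addr0.
Qed.

(** From the extreme ray [m1], the pivot direction [m] is oriented so that [m w1 > 0]; the weight
    that then vanishes first sits at some [w2] other than [w1]. *)
Lemma two_facets l : conic s q l -> exists m1 m2 w1 w2,
  [/\ conic s q m1, conic s q m2, w1 \in s, w2 \in s & [/\ w1 != w2, m1 w1 = 0 & m2 w2 = 0]].
Proof.
case/has_facet=> m1 [w1 [cm1 w1s mw1]]; have [m10 sm1 nm1 km1] := cm1.
have [w' w's ww'] : exists2 w', w' \in s & w' != w1.
  have : (0 < #|s :\ w1|)%N by rewrite (card_setD1 w1s cs).
  by case/card_gt0P => w'; rewrite !inE => /andP[]; exists w'.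
have [m [sm km mw' [w0 mw0]]] := kernel_vanishing w's.
have mw1N : m w1 != 0.
  apply/eqP => mw10; move: mw0.
  by rewrite (two_zeros_eq0 sm km w's w1s ww' mw' mw10) eqxx.
wlog mw1P : m sm km mw' mw0 mw1N / 0 < m w1.
  move=> wl; have [|mneg] := ltP 0 (m w1); first exact: wl.
  apply: (wl (fun w => 0 + (-1) * m w)).
  - by apply: suppD.
  - by apply: killsD => // p _; rewrite big1 // => w _; rewrite mul0r.
  - by rewrite mw' mulr0 addr0.
  - by rewrite add0r mulN1r oppr_eq0.
  - by rewrite add0r mulN1r oppr_eq0.
  - by rewrite add0r mulN1r oppr_gt0 lt_neqAle mw1N.
have [[w mw]|mge] := pselect (exists w, m w < 0); last first.
  exists m1, m, w1, w'; split=> //; last by rewrite eq_sym.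
  split=> //; last by exists w0.
  by move=> w; rewrite leNgt; apply/negP => mw; apply: mge; exists w.
have [|t [t0 lt [w2 [mw2 lw2]]]] := ratio_test m10 _ (ex_intro _ w mw).
  move=> c mc; have [->|cw] := eqVneq c w1; first exact: ltW.
  have [cs'|/sm->//] := boolP (c \in s).
  by case: nm1 => w3; rewrite (two_zeros_eq0 sm1 km1 cs' w1s cw mc mw1) eqxx.
have w2s : w2 \in s by apply: (nonzero_in sm); rewrite lt_eqF.
exists m1, (fun w => m1 w + t * m w), w1, w2; split=> //.
  split=> //; [exact: suppD| |exact: killsD].
  by exists w1; rewrite mw1 add0r mulf_neq0 // gt_eqF.
by split=> //; apply: contraTneq mw2 => <-; rewrite -leNgt ltW.
Qed.

Lemma conic_pos m w1 w : conic s q m -> w1 \in s -> m w1 = 0 -> w \in s -> w != w1 -> 0 < m w.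
Proof.
case=> m0 sm [w0 mw0] km w1s mw1 ws ww1; rewrite lt_def m0 andbT.
by apply/eqP => mw; move: mw0; rewrite (two_zeros_eq0 sm km ws w1s ww1 mw mw1) eqxx.
Qed.

(** The coefficients are read off at [w2] and [w1], where one of the two extreme combinations
    vanishes; the difference of both sides then has two zeros. *)
Lemma conic_decomp m1 m2 w1 w2 l : conic s q m1 -> conic s q m2 -> w1 \in s -> w2 \in s ->
    w1 != w2 -> m1 w1 = 0 -> m2 w2 = 0 -> conic s q l ->
  forall w, l w = l w2 / m1 w2 * m1 w + l w1 / m2 w1 * m2 w.
Proof.
move=> c1 c2 w1s w2s w12 m11 m22 [l0 sl nl kl].
have p1 : 0 < m1 w2 by apply: (conic_pos c1 w1s); rewrite // eq_sym.
have p2 : 0 < m2 w1 by apply: (conic_pos c2 w2s).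
case: c1 c2 => [m10 sm1 nm1 km1] [m20 sm2 nm2 km2].
pose r w := l w + (- (l w2 / m1 w2)) * m1 w + (- (l w1 / m2 w1)) * m2 w.
have r0 : forall w, r w = 0.
  apply: (@two_zeros_eq0 r w1 w2) => //.
  - by apply: suppD => //; apply: suppD.
  - by apply: killsD => //; apply: killsD.
  - by rewrite /r m11 mulr0 addr0 mulNr divfK ?subrr // gt_eqF.
  - by rewrite /r m22 mulr0 addr0 mulNr divfK ?subrr // gt_eqF.
by move=> w; apply/eqP; rewrite -subr_eq0 -(r0 w) /r opprD !mulNr addrA.
Qed.

End OneDim.

(* The combinations killing the first [q] coordinates form a planar cone whose two extreme rays lie on
   facets of [s]; the origin is in the hull iff coordinate [q] has opposite signs on these rays. *)
Lemma origin_in_hull_coboundary q (s : {set W}) : (q < D)%N -> #|s| = q.+2 ->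
  origin_in_hull q.+1 s = \big[addb/false]_(w in s) meets_ray q (s :\ w).
Proof.
move=> qD cs; have qD' := ltnW qD.
have conicW (w : W) l k : conic (s :\ w) k l -> conic s k l.
  by case=> ? sl ? ?; split=> // v vs; apply: sl; rewrite !inE (negPf vs) andbF.
have [[l cl]|nc] := pselect (exists l, conic s q l); last first.
  rewrite big1 => [|w ws].
    apply/asboolPn => -[l [? ? ? kl]]; apply: nc; exists l; split=> // p pq.
    by apply: kl; rewrite ltnS ltnW.
  by apply/asboolPn => -[l /conicW cl _]; apply: nc; exists l.
have [m1 [m2 [w1 [w2 [c1 c2 w1s w2s [w12 m11 m22]]]]]] := two_facets qD' cs cl.
have dec := conic_decomp qD' cs c1 c2 w1s w2s w12 m11 m22.
have p1 w : w \in s -> w != w1 -> 0 < m1 w := conic_pos qD' cs c1 w1s m11.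
have p2 w : w \in s -> w != w2 -> 0 < m2 w := conic_pos qD' cs c2 w2s m22.
have p12 : 0 < m1 w2 by rewrite p1 // eq_sym.
have p21 : 0 < m2 w1 by rewrite p2.
pose h l := \sum_w l w * a w q.
have hdec m : conic s q m -> h m = m w2 / m1 w2 * h m1 + m w1 / m2 w1 * h m2.
  move=> cm; rewrite /h !mulr_sumr -big_split /=; apply: eq_bigr => w _.
  by rewrite (dec _ cm) mulrDl !mulrA.
have facet m w : conic s q m -> w \in s -> m w = 0 -> supported (s :\ w) m.
  by case=> _ sm _ _ ws mw v; rewrite !inE negb_and negbK => /orP[/eqP->|/sm].
(* A zero would give a nontrivial relation on the [q + 1] points of a facet that kills [q + 1]
   coordinates, against genericity. *)
have hN0 m w : conic s q m -> w \in s -> m w = 0 -> h m != 0.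
  move=> cm ws mw; apply/eqP => hm; case: (cm) => _ _ [v mv] km.
  move: mv; rewrite (@genD q.+1 (s :\ w) m) ?eqxx //.
  - exact: card_setD1.
  - exact: facet.
  - by move=> p; rewrite ltnS leq_eqVlt => /predU1P[->|/km].
have h1 := hN0 _ _ c1 w1s m11; have h2 := hN0 _ _ c2 w2s m22.
have psi_h m w : conic s q m -> w \in s -> m w = 0 ->
    (forall m', conic (s :\ w) q m' -> exists2 c, 0 <= c & h m' = c * h m) ->
    meets_ray q (s :\ w) = (h m < 0).
  move=> cm ws mw uniq; apply/asboolP/idP => [[m' /uniq[c c0 hm']]|hm].
    by rewrite -/(h m') hm' => hlt; rewrite ltNge; apply: contraTN hlt => hm;
       rewrite -leNgt mulr_ge0.
  exists m => //; case: (cm) => ? ? ? ?; split=> //; exact: facet.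
have psi1 : meets_ray q (s :\ w1) = (h m1 < 0).
  apply: psi_h => // m' cm'; exists (m' w2 / m1 w2).
    by case: cm' => m0 *; rewrite divr_ge0 // ltW.
  rewrite (hdec _ (conicW _ _ _ cm')); case: cm' => _ sm' _ _.
  by rewrite (sm' w1) ?inE ?eqxx // !mul0r addr0.
have psi2 : meets_ray q (s :\ w2) = (h m2 < 0).
  apply: psi_h => // m' cm'; exists (m' w1 / m2 w1).
    by case: cm' => m0 *; rewrite divr_ge0 // ltW.
  rewrite (hdec _ (conicW _ _ _ cm')); case: cm' => _ sm' _ _.
  by rewrite (sm' w2) ?inE ?eqxx // !mul0r add0r.
(* No other facet carries a combination: at its missing point [m1] and [m2] are both positive, so
   both coefficients would be zero. *)
rewrite (bigD1 w1) //= (bigD1 w2) /=; last by rewrite w2s eq_sym.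
rewrite big1 => [|w /andP[/andP[ws ww1] ww2]]; last first.
  apply/asboolPn => -[m cm _].
  have mw : m w = 0 by case: cm => _ -> //; rewrite !inE eqxx.
  case: (cm) => m0 _ [v mv] _.
  have := dec _ (conicW _ _ _ cm) w; rewrite mw => /esym/eqP.
  have P1 := p1 w ws ww1; have P2 := p2 w ws ww2.
  have e1 : 0 <= m w2 / m1 w2 by rewrite divr_ge0 // ltW.
  have e2 : 0 <= m w1 / m2 w1 by rewrite divr_ge0 // ltW.
  rewrite paddr_eq0 ?(mulr_ge0 e1 (ltW P1)) ?(mulr_ge0 e2 (ltW P2)) //.
  rewrite !mulf_eq0 (gt_eqF P1) (gt_eqF P2) !invr_eq0 (gt_eqF p12) (gt_eqF p21) !orbF.
  move=> /andP[/eqP z2 /eqP z1]; move: mv.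
  by rewrite (dec _ (conicW _ _ _ cm)) z1 z2 !mul0r addr0 eqxx.
rewrite psi1 psi2 addbF.
have chiP m : conic s q m -> h m = 0 -> origin_in_hull q.+1 s.
  move=> [? ? ? km] hm; apply/asboolP; exists m; split=> // p.
  by rewrite ltnS leq_eqVlt => /predU1P[->|/km].
(* If the extreme rays lie on opposite sides, the positive factor [t] balances coordinate [q] to
   zero. *)
have comb : (h m1 < 0) (+) (h m2 < 0) -> origin_in_hull q.+1 s.
  move=> sg; pose t := - (h m1 / h m2).
  have t0 : 0 < t.
    rewrite /t -mulNr; case: (ltgtP (h m1) 0) sg h1 => // g1; case: (ltgtP (h m2) 0) h2 => //= g2 _ _ _.
      by rewrite divr_gt0 // oppr_gt0.
    by rewrite mulNr -mulrN -invrN divr_gt0 // oppr_gt0.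
  apply: (chiP (fun w => m1 w + t * m2 w)).
    case: c1 c2 => [m10 sm1 nm1 km1] [m20 sm2 nm2 km2].
    split; [|exact: suppD| |exact: killsD].
      by move=> w; rewrite addr_ge0 // mulr_ge0 // ltW.
    by exists w1; rewrite m11 add0r mulf_neq0 // gt_eqF.
  rewrite /h; under eq_bigr do rewrite mulrDl -mulrA.
  by rewrite big_split -mulr_sumr /= -/(h m1) -/(h m2) /t mulNr divfK // subrr.
apply/idP/idP => // /asboolP[m [m0 sm [v mv] km]].
have cm : conic s q m by split=> // [|p pq]; [exists v|apply: km; rewrite ltnS ltnW].
have := hdec m cm; rewrite [h m]km //.
set b1 := _ / _; set b2 := _ / _ => hm.
have b10 : 0 <= b1 by rewrite divr_ge0 // ltW.
have b20 : 0 <= b2 by rewrite divr_ge0 // ltW.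
have bN : (b1 != 0) || (b2 != 0).
  rewrite -negb_and; apply: contra mv => /andP[/eqP z1 /eqP z2].
  by rewrite (dec _ cm) -/b1 -/b2 z1 z2 !mul0r addr0.
case: (ltgtP (h m1) 0) h1 => // g1 _; case: (ltgtP (h m2) 0) h2 => // g2 _; exfalso.
  move: bN hm; rewrite !neq_lt !ltNge b10 b20 /= -!ltNge; nra.
move: bN hm; rewrite !neq_lt !ltNge b10 b20 /= -!ltNge; nra.
Qed.
End Pivot.

(** * Mod 2 chains of rainbow simplices *)

Section Chains.
Set Implicit Arguments. Unset Strict Implicit.
Variables (W C : finType) (pl : W -> C).
Implicit Types (z y : {set W} -> bool) (s t B : {set W}) (a w : W).

(* A mod 2 chain is a predicate on vertex sets. The empty set is a simplex (augmented complex),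
   and [k] in [chain_in k] counts vertices. *)
Definition boundary z t := \big[addb/false]_(w | w \notin t) z (w |: t).
Definition cone a z t := (a \in t) && z (t :\ a).
Definition rainbow s := {in s &, injective pl}.
Definition chain_in k B z := forall s, z s -> [/\ #|s| = k, rainbow s & s \subset B].

Lemma big_addb_true (I : finType) (P f : pred I) :
  \big[addb/false]_(i | P i) f i -> exists2 i, P i & f i.
Proof.
move=> fP; apply: contrapT => nf; move: fP; rewrite big1 // => i Pi.
by apply/negP => fi; apply: nf; exists i.
Qed.

Lemma boundary_add z y t : boundary (fun s => z s (+) y s) t = boundary z t (+) boundary y t.
Proof. exact: big_split. Qed.

Lemma boundary_sum (I : finType) (P : pred I) (f : I -> {set W} -> bool) t :
  boundary (fun s => \big[addb/false]_(i | P i) f i s) t =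
  \big[addb/false]_(i | P i) boundary (f i) t.
Proof. exact: exchange_big. Qed.

Lemma eq_boundary z y : z =1 y -> boundary z =1 boundary y.
Proof. by move=> zy t; apply: eq_bigr => w _; apply: zy. Qed.

(** The cone formula holds for every [z]: if [t] contains [a], the term [z t] cancels against the
    summand [w = a] in the boundary of [z]. *)
Lemma boundary_cone a z t : boundary (cone a z) t = z t (+) cone a (boundary z) t.
Proof.
rewrite /boundary /cone; have [at_|at_] /= := boolP (a \in t); last first.
  rewrite addbF (bigD1 a) //= setU11 setU1K //= big1 ?addbF // => w /andP[wt wa].
  by rewrite !inE eq_sym (negPf wa) (negPf at_).
have aw w : (a \in w |: t) by rewrite !inE at_ orbT.
under eq_bigr do rewrite aw /=.
rewrite [in RHS](bigD1 a) /=; last by rewrite !inE eqxx.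
rewrite setD1K // addbA addbb /=.
apply: eq_big => [w|w wt]; first by rewrite !inE; case: eqVneq => [->|_] /=; rewrite ?at_ ?andbT.
congr z; apply/setP => v; rewrite !inE; case: (eqVneq v a) => //= ->.
by case: eqVneq wt => // <-; rewrite at_.
Qed.

Lemma cone_chain_in a k B' B z : a \in B -> B' \subset B ->
    (forall w, w \in B' -> pl w != pl a) -> chain_in k B' z ->
  chain_in k.+1 B (cone a z).
Proof.
move=> aB sB dif zc s /andP[as_ /zc[card_s rs ss]]; split.
- by rewrite (cardsD1 a) as_ card_s.
- have ne w : w \in s -> w != a -> pl w != pl a.
    by move=> ws wa; apply: dif; apply: (subsetP ss); rewrite !inE wa.
  move=> v w vs ws; have [->|va] := eqVneq v a; have [->|wa] := eqVneq w a => // e.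
  + by have := ne w ws wa; rewrite e eqxx.
  + by have := ne v vs va; rewrite e eqxx.
  + by apply: rs; rewrite // !inE ?va ?wa.
- by rewrite -(setD1K as_) subUset sub1set aB (subset_trans ss).
Qed.

(* The rainbow sets in [B] form a join of [#|pl @: B|] discrete sets. A cycle is filled by coning off
   one player and filling the links of that player's vertices by induction. *)
Lemma chain_filling k B z : chain_in k B z -> (forall t, boundary z t = false) ->
  k < #|pl @: B| -> exists2 y, chain_in k.+1 B y & boundary y =1 z.
Proof.
elim: k B z => [|k IH] B z zc z0 Bk.
  have /card_gt0P[_ /imsetP[a aB _]] := Bk.
  exists (cone a z); last by move=> t; rewrite boundary_cone /cone z0 andbF addbF.
  apply: (cone_chain_in aB (sub0set B)) => [w|]; first by rewrite inE.
  move=> s /zc[/eqP]; rewrite cards_eq0 => /eqP-> _ _.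
  by split; rewrite ?cards0 ?sub0set // => w; rewrite inE.
have /card_gt0P[_ /imsetP[a0 a0B _]] := leq_trans (ltn0Sn _) Bk.
pose B' := [set w in B | pl w != pl a0].
pose fib := [set w in B | pl w == pl a0].
have sB' : B' \subset B by apply/subsetP => w; rewrite inE => /andP[].
have B'k : k < #|pl @: B'|.
  rewrite -ltnS (leq_trans Bk) // -add1n.
  have -> : 1 = #|[set pl a0]| by rewrite cards1.
  apply: leq_trans (leq_card_setU _ _); apply: subset_leq_card.
  apply/subsetP => _ /imsetP[w wB ->]; rewrite !inE.
  by case: eqVneq => //= ne; apply: imset_f; rewrite inE wB.
have fibB a : a \in fib -> a \in B by rewrite inE => /andP[].
have fibB' a w : a \in fib -> w \in B' -> pl w != pl a.
  by rewrite !inE => /andP[_ /eqP->] /andP[].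
have fib_notin a s : a \in fib -> s \subset B' -> a \notin s.
  by move=> af sB; apply/negP => /(subsetP sB)/(fibB' _ _ af); rewrite eqxx.
(* [z_ a] is the link of [a] away from the player of [a0], and [zz] is the part of [z] without
   vertices of that player. *)
pose z_ a s := (s \subset B') && z (a |: s).
pose zz s := z s && (s \subset B').
have z_c a : a \in fib -> chain_in k B' (z_ a).
  move=> af s /andP[sB /zc[cs rs _]]; split=> //.
    by move: cs; rewrite cardsU1 (fib_notin a) // => -[].
  by move=> v w vs ws; apply: rs; apply: setU1r.
have z_0 a t : a \in fib -> boundary (z_ a) t = false.
  move=> af; have [tB|tB] := boolP (t \subset B'); last first.
    by apply: big1 => w _; rewrite /z_ subUset (negPf tB) andbF.
  rewrite -(z0 (a |: t)) /boundary [LHS]big_mkcond [RHS]big_mkcond /=.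
  apply: eq_bigr => w _; rewrite /z_ subUset tB andbT sub1set setUCA.
  have [wB|wB] /= := boolP (w \in B').
    by rewrite !inE; case: eqVneq wB => // ->; move/(fibB' _ _ af); rewrite eqxx.
  rewrite if_same; case: ifP => // wat; apply/esym/negP => /zc[_ rs ss].
  have wB0 : w \in B by apply: (subsetP ss); rewrite !inE eqxx.
  have wf : w \in fib by move: wB; rewrite !inE wB0 /= negbK.
  move: wat; rewrite !inE negb_or => /andP[/eqP wa _]; apply: wa.
  apply: rs; rewrite ?inE ?eqxx ?orbT //.
  by move: af wf; rewrite !inE => /andP[_ /eqP->] /andP[_ /eqP->].
(* A rainbow simplex has at most one vertex of the player of [a0], so [z] is the sum of [zz] and the
   cones over the links. *)
have zdec t : z t = zz t (+) \big[addb/false]_(a in fib) cone a (z_ a) t.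
  rewrite /zz; have [zt|zt] /= := boolP (z t); last first.
    apply/esym/big1 => a af; apply/negP => /and3P[at_ _].
    by rewrite setD1K // (negPf zt).
  have [ct rt st] := zc t zt.
  have [tB|/subsetPn[a at_ aB]] /= := boolP (t \subset B').
    apply/esym/negP => /big_addb_true[a af /andP[at_ _]].
    by move: at_; rewrite (negPf (fib_notin _ _ af tB)).
  have af : a \in fib by move: aB; rewrite !inE (subsetP st) //= negbK.
  have pla w : w \in fib -> pl w = pl a0 by rewrite inE => /andP[_ /eqP].
  rewrite (bigD1 a) //= big1 => [|w /andP[wf wa]].
    rewrite addbF /cone /z_ at_ setD1K // zt andbT; apply/esym/subsetP => w.
    rewrite !inE => /andP[wa wt]; rewrite (subsetP st) //=.
    apply: contra_neq wa => e; apply: rt => //; by rewrite e pla.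
  apply/negP => /andP[wt _]; case/eqP: wa; apply: rt => //.
  by rewrite !pla.
have zz0 t : boundary zz t = \big[addb/false]_(a in fib) z_ a t.
  have := z0 t; rewrite (eq_boundary zdec) boundary_add boundary_sum.
  under eq_bigr => a af do rewrite boundary_cone /cone (z_0 _ _ af) andbF addbF.
  by case: (boundary zz t) (\big[_/_]_(_ in _) _) => [] [].
have /choice[Y YP] : forall a, exists y,
    a \in fib -> chain_in k.+1 B' y /\ boundary y =1 z_ a.
  move=> a; have [af|_] := boolP (a \in fib); last by exists (fun=> false).
  have [t|y yc yz] := IH B' (z_ a) (z_c _ af) _ B'k; first exact: z_0.
  by exists y.
have a0f : a0 \in fib by rewrite inE a0B eqxx.
(* Coning [zz] off from [a0] leaves the error [cone a0 (boundary zz)], which is the sum of the cones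
   from [a0] over the links. Suspending each filling [Y a] between [a] and [a0] trades such a cone
   for the one from [a]. *)
exists (fun t => cone a0 zz t (+)
    \big[addb/false]_(a in fib) (cone a (Y a) t (+) cone a0 (Y a) t)).
  have cc a y : a \in fib -> chain_in k.+1 B' y -> chain_in k.+2 B (cone a y).
    by move=> af; apply: cone_chain_in => // [|w]; [exact: fibB|exact: fibB'].
  move=> s; have [czs _|_ /big_addb_true[a af]] := boolP (cone a0 zz s).
    apply: (cc a0 zz) => // {czs}s /andP[/zc[cs rs _] sB]; split=> //.
  have [Yc _] := YP a af.
  have [cs _|_ /= cs] := boolP (cone a (Y a) s); [exact: (cc a (Y a))|exact: (cc a0 (Y a))].
move=> t; rewrite boundary_add boundary_sum boundary_cone zdec -!addbA; congr (_ (+) _).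
under eq_bigr => a af.
  rewrite boundary_add !boundary_cone; have [_ Yz] := YP a af.
  have -> : boundary (Y a) = z_ a by apply: funext.
  over.
have -> : cone a0 (boundary zz) t = \big[addb/false]_(a in fib) cone a0 (z_ a) t.
  rewrite /cone zz0; case: (a0 \in t) => //=.
  by rewrite big1.
rewrite -big_split; apply: eq_bigr => a _ /=.
by case: (Y a t); case: (cone a (z_ a) t); case: (cone a0 (z_ a) t).
Qed.

(** Both sides count, mod 2, the pairs of a simplex of [g] and a vertex whose removal leaves a set
    satisfying [ps]. *)
Lemma stokes (ps : {set W} -> bool) (g : {set W} -> bool) :
  \big[addb/false]_s (g s && \big[addb/false]_(w in s) ps (s :\ w)) =
  \big[addb/false]_t (boundary g t && ps t).
Proof.
under eq_bigr do rewrite big_distrr /= big_mkcond /=.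
under [in RHS]eq_bigr do rewrite /boundary big_distrl /= big_mkcond /=.
rewrite exchange_big [RHS]exchange_big; apply: eq_bigr => w _ /=.
rewrite -!big_mkcond /= (reindex_onto (fun t => w |: t) (fun s => s :\ w)) /=.
  apply: eq_big => [t|t]; rewrite ?setU11 /=.
    apply/eqP/idP => [<-|]; [by rewrite !inE eqxx|exact: setU1K].
  by move=> /eqP->.
by move=> s ws; apply: setD1K.
Qed.
End Chains.

(** * Cubical cells of the grid and their rainbow chains *)

Section Grid.
Set Implicit Arguments. Unset Strict Implicit.
Import Order.TTheory GRing.Theory Num.Theory.
Variables (D N : nat) (W C : finType).
Let G := {ffun 'I_D -> 'I_N.+1}.
Variables (pos : W -> G) (pl : W -> C).
Implicit Types (v : G) (A : {set 'I_D}) (p r : 'I_D) (s t : {set W}).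

Definition shift p v : G := [ffun i => if i == p then inord (v i).+1 else v i].
Definition valid v A := forall p, p \in A -> v p < N.
Definition cube v A := [set w | [forall i, v i <= pos w i <= v i + (i \in A)]].
(* The cell [(v, A)] is the cube with lowest corner [v] spanned by the directions in [A]. *)
Definition cell_boundary (phi : G -> {set 'I_D} -> {set W} -> bool) v A s :=
  if A == set0 then s == set0 else
  \big[addb/false]_(p in A) (phi v (A :\ p) s (+) phi (shift p v) (A :\ p) s).

Lemma shiftE p v : v p < N -> shift p v p = (v p).+1 :> nat.
Proof. by move=> vp; rewrite ffunE eqxx inordK. Qed.

Lemma shift_neq p v i : i != p -> shift p v i = v i.
Proof. by rewrite ffunE => /negPf->. Qed.

Lemma shiftC p r v : p != r -> shift p (shift r v) = shift r (shift p v).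
Proof.
move=> pr; apply/ffunP => i; rewrite !ffunE.
by case: (eqVneq i p) => [->|//]; rewrite (negPf pr).
Qed.

Lemma valid_facet v A p : valid v A -> valid v (A :\ p).
Proof. by move=> vA r /setD1P[_ /vA]. Qed.

Lemma valid_facet_shift v A p : valid v A -> valid (shift p v) (A :\ p).
Proof. by move=> vA r /setD1P[rp /vA]; rewrite shift_neq. Qed.

Lemma cube_facet v A p : cube v (A :\ p) \subset cube v A.
Proof.
apply/subsetP => w; rewrite !inE => /forallP vw; apply/forallP => i.
have /andP[-> h] := vw i; apply: leq_trans h _.
by rewrite leq_add2l !inE; case: (i == p); case: (i \in A).
Qed.

Lemma cube_facet_shift v A p : p \in A -> valid v A -> cube (shift p v) (A :\ p) \subset cube v A.
Proof.
move=> pA vA; apply/subsetP => w; rewrite !inE => /forallP vw; apply/forallP => i.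
have := vw i; rewrite !inE; have [->|ip] /= := eqVneq i p.
  by rewrite (shiftE (vA _ pA)) pA addn0 addn1 => /andP[/ltnW-> ->].
by rewrite shift_neq.
Qed.

(** The pairs with [r < p] and those with [p < r] contribute the same amount, which cancels mod
    2. *)
Lemma big_addb_sym A (X : 'I_D -> 'I_D -> bool) : (forall p r, X p r = X r p) ->
  \big[addb/false]_(p in A) \big[addb/false]_(r in A :\ p) X p r = false.
Proof.
move=> symX.
pose S1 := \big[addb/false]_(p in A) \big[addb/false]_(r in A | r < p) X p r.
pose S2 := \big[addb/false]_(p in A) \big[addb/false]_(r in A | p < r) X p r.
have -> : \big[addb/false]_(p in A) \big[addb/false]_(r in A :\ p) X p r = S1 (+) S2.
  rewrite /S1 /S2 -big_split; apply: eq_bigr => p _ /=.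
  rewrite (bigID (fun r : 'I_D => r < p)) /=; congr (_ (+) _); apply: eq_bigl => r.
    by rewrite !inE; case: eqVneq => [->|]; rewrite ?ltnn ?andbF.
  rewrite !inE -leqNgt leq_eqVlt -val_eqE /= eq_sym.
  by case: eqP => [->|]; rewrite ?ltnn ?andbF ?andbT.
suff -> : S1 = S2 by rewrite addbb.
rewrite /S1 /S2 (exchange_big_dep (fun r => r \in A)) /=; last by move=> p r _ /andP[].
by apply: eq_bigr => r rA; apply: eq_big => [p|p _]; rewrite ?rA.
Qed.

Hypothesis hungry_pl : forall v, D < #|pl @: [set w | pos w == v]|.

(** In dimension at least two, each codimension-two face is reached through two facets, since shifts
    commute. In dimension one the two endpoints each contribute one empty simplex. *)
Lemma boundary_cell_boundary phi v A : valid v A ->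
    (forall v' A', valid v' A' -> #|A'| < #|A| -> boundary (phi v' A') =1 cell_boundary phi v' A') ->
  forall t, boundary (cell_boundary phi v A) t = false.
Proof.
move=> vA IH t; have [A0|AN0] := eqVneq A set0.
  apply: big1 => w _; rewrite /cell_boundary A0 eqxx.
  by apply/negbTE/set0Pn; exists w; rewrite setU11.
have -> : cell_boundary phi v A = fun s => \big[addb/false]_(p in A)
    (phi v (A :\ p) s (+) phi (shift p v) (A :\ p) s).
  by apply: funext => s; rewrite /cell_boundary (negPf AN0).
have cA p : p \in A -> #|A :\ p| < #|A| by move=> pA; rewrite (cardsD1 p A) pA.
rewrite boundary_sum; under eq_bigr => p pA.
  rewrite boundary_add IH ?cA //; last exact: valid_facet.
  rewrite IH ?cA //; last exact: valid_facet_shift.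
  over.
have [[p A1]|nA1] := pselect (exists p, A = [set p]).
  by rewrite A1 big_set1 setDv /cell_boundary eqxx addbb.
under eq_bigr => p pA.
  have ApN0 : A :\ p != set0.
    by apply: contra_notN nA1 => /eqP e; exists p; rewrite -(setD1K pA) e setU0.
  rewrite /cell_boundary (negPf ApN0) -big_split /=.
  over.
rewrite -[RHS](@big_addb_sym A (fun p r => (phi v (A :\ p :\ r) t (+) phi (shift r v) (A :\ p :\ r) t) (+) (phi (shift p v) (A :\ p :\ r) t (+) phi (shift r (shift p v)) (A :\ p :\ r) t))) //.
move=> p r; have [->//|pr] := eqVneq p r.
rewrite (shiftC v pr) !setDDl [[set r] :|: _]setUC.
exact: addbACA.
Qed.

(** An acyclic carrier argument by induction on dimension: the boundary of a cell is a rainbow cycle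
    over its cube, whose corner [v] alone supplies more than [D] players, so [chain_filling]
    applies. *)
Lemma rainbow_chain_map k : k <= D.+1 -> exists phi, forall v A, valid v A -> #|A| < k ->
  chain_in pl #|A|.+1 (cube v A) (phi v A) /\ boundary (phi v A) =1 cell_boundary phi v A.
Proof.
elim: k => [|k IH] kD; first by exists (fun _ _ _ => false).
have [phi phiP] := IH (ltnW kD).
have : forall vA : G * {set 'I_D}, exists y, valid vA.1 vA.2 -> #|vA.2| = k ->
    chain_in pl k.+1 (cube vA.1 vA.2) y /\ boundary y =1 cell_boundary phi vA.1 vA.2.
  case=> v A /=; have [[vA cA]|nvA] := pselect (valid v A /\ #|A| = k); last first.
    by exists (fun=> false) => vA cA; case: nvA.
  have [|t||y yc yb] := @chain_filling _ _ pl k (cube v A) (cell_boundary phi v A); last by exists y.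
  - move=> s; rewrite /cell_boundary; case: eqVneq => [A0 /eqP->|AN0].
      split; rewrite ?sub0set // ?cards0 -?cA ?A0 ?cards0 //.
      by move=> x; rewrite inE.
    case/big_addb_true=> p pA.
    have cp : #|A :\ p|.+1 = k by rewrite -cA (cardsD1 p A) pA.
    have [phis _|_ /= phis] := boolP (phi v (A :\ p) s).
      have [|pc _] := phiP v (A :\ p) (valid_facet (p := p) vA); first by rewrite cp.
      have [cs rs ss] := pc s phis; rewrite cp in cs; split=> //.
      exact: subset_trans ss (cube_facet _ _ _).
    have [|pc _] := phiP _ (A :\ p) (valid_facet_shift (p := p) vA); first by rewrite cp.
    have [cs rs ss] := pc s phis; rewrite cp in cs; split=> //.
    exact: subset_trans ss (cube_facet_shift pA vA).
  - apply: boundary_cell_boundary => // v' A' vA' cA'; case: (phiP v' A' vA') => //.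
    by rewrite -cA.
  - apply: leq_ltn_trans (kD : k <= D) (leq_trans (hungry_pl v) _).
    apply/subset_leq_card/imsetS/subsetP => w; rewrite !inE => /eqP->.
    by apply/forallP => i; rewrite leqnn leq_addr.
case/choice=> Y YP.
exists (fun v A => if #|A| < k then phi v A else Y (v, A)) => v A vA.
have bdc : #|A| <= k -> cell_boundary (fun v A => if #|A| < k then phi v A else Y (v, A)) v A
    = cell_boundary phi v A.
  move=> cA; apply: funext => s; rewrite /cell_boundary; case: eqVneq => // AN0.
  apply: eq_bigr => p pA; suff -> : #|A :\ p| < k by [].
  by rewrite (leq_trans _ cA) // (cardsD1 p A) pA.
rewrite ltnS => cA; rewrite bdc //; case: ltnP => cA'; first exact: phiP.
have ck : #|A| = k by apply/eqP; rewrite eqn_leq cA.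
by rewrite ck; apply: (YP (v, A)).
Qed.
End Grid.

(** * Rainbow Poincare-Miranda theorem *)

Section Degree.
Set Implicit Arguments. Unset Strict Implicit.
Import Order.TTheory GRing.Theory Num.Theory.
Variables (F : realFieldType) (D N : nat) (W C : finType).
Let G := {ffun 'I_D -> 'I_N.+1}.
Variables (pos : W -> G) (pl : W -> C) (a : W -> nat -> F).
Hypothesis gen : generic a D.
Hypothesis a_pos : forall w (p : 'I_D), pos w p = 0 :> nat -> (0 < a w p)%R.
Hypothesis a_neg : forall w (p : 'I_D), pos w p = N :> nat -> (a w p < 0)%R.

Definition face q : {set 'I_D} := [set p : 'I_D | p < q].
(* The flag of faces of the grid: on the [q]-th one all coordinates from [q] on equal [N]. *)
Definition on_face q (p : 'I_D) (v : G) := if p < q then v p < N else v p == N :> nat.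
Definition face_cell q (v : G) := [forall p, on_face q p v].

Lemma conic_sum_gt0 s q l (p : nat) : conic a s q l ->
  (forall w, w \in s -> (0 < a w p)%R) -> (0 < \sum_w l w * a w p)%R.
Proof.
case=> l0 sl [w lw] _ ap; have ws : w \in s by apply: contraNT lw => /sl->.
rewrite (bigD1 w) //= ltr_wpDr //.
  apply: sumr_ge0 => v _; have [/ap vs|/sl->] := boolP (v \in s); last by rewrite mul0r.
  by rewrite mulr_ge0 // ltW.
by rewrite mulr_gt0 ?ap // lt_def lw l0.
Qed.

Lemma conic_sum_lt0 s q l (p : nat) : conic a s q l ->
  (forall w, w \in s -> (a w p < 0)%R) -> (\sum_w l w * a w p < 0)%R.
Proof.
case=> l0 sl [w lw] _ ap; have ws : w \in s by apply: contraNT lw => /sl->.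
rewrite -oppr_gt0 -sumrN (bigD1 w) //= ltr_wpDr //.
  apply: sumr_ge0 => v _; have [/ap vs|/sl->] := boolP (v \in s); last by rewrite mul0r oppr0.
  by rewrite -mulrN mulr_ge0 // oppr_ge0 ltW.
by rewrite -mulrN mulr_gt0 ?oppr_gt0 ?ap // lt_def lw l0.
Qed.

Variable phi : G -> {set 'I_D} -> {set W} -> bool.
Hypothesis phiP : forall v A, valid v A ->
  chain_in pl #|A|.+1 (cube pos v A) (phi v A) /\ boundary (phi v A) =1 cell_boundary phi v A.

Lemma card_face q : q <= D -> #|face q| = q.
Proof.
move=> qD; rewrite -sum1_card; under eq_bigl do rewrite inE.
by rewrite -(big_ord_widen _ (fun=> 1) qD) sum1_card card_ord.
Qed.

Lemma face_rem q (qD : q < D) : face q.+1 :\ Ordinal qD = face q.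
Proof. by apply/setP => p; rewrite !inE ltnS leq_eqVlt -val_eqE /=; case: ltngtP. Qed.

Lemma cube_pos v A w p : w \in cube pos v A -> p \notin A -> pos w p = v p.
Proof.
rewrite inE => /forallP/(_ p) h pA; apply: val_inj; apply/eqP.
by move: h; rewrite (negPf pA) addn0 eq_sym eqn_leq.
Qed.

(* The count on face [q.+1] equals a count of ray crossings on its boundary. By the sign conditions
   the ray [x_0 = .. = x_(q-1) = 0 > x_q] only meets the facet [x_q = N], which is face [q]. *)
Lemma flag_step q : q < D ->
  \big[addb/false]_(v | face_cell q.+1 v) \big[addb/false]_s (phi v (face q.+1) s && origin_in_hull a q.+1 s) =
  \big[addb/false]_(v | face_cell q v) \big[addb/false]_s (phi v (face q) s && origin_in_hull a q s).
Proof.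
move=> qD; set A := face q.+1; pose pq := Ordinal qD.
have ltq (r : 'I_D) : r != pq -> (r < q.+1) = (r < q).
  by move=> rp; rewrite ltnS leq_eqVlt; case: eqP => // e; case/eqP: rp; apply: val_inj.
have cell_valid v : face_cell q.+1 v -> valid v A.
  by move=> /forallP fv p; rewrite inE => pq'; have := fv p; rewrite /on_face pq'.
(* [P v p] counts the ray crossings on the facet through [v] orthogonal to direction [p]. *)
pose P v p := \big[addb/false]_t (phi v (A :\ p) t && meets_ray a q t).
have -> : \big[addb/false]_(v | face_cell q.+1 v) \big[addb/false]_s (phi v A s && origin_in_hull a q.+1 s) =
    \big[addb/false]_(v | face_cell q.+1 v) \big[addb/false]_(p in A) (P v p (+) P (shift p v) p).
  apply: eq_bigr => v fv; have vA := cell_valid v fv; have [pc pb] := phiP vA.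
  have -> : \big[addb/false]_s (phi v A s && origin_in_hull a q.+1 s) =
      \big[addb/false]_s (phi v A s && \big[addb/false]_(w in s) meets_ray a q (s :\ w)).
    apply: eq_bigr => s _; case e: (phi v A s) => //=; apply: origin_in_hull_coboundary gen _ _ _ _ => //.
    by have [-> _ _] := pc s e; rewrite card_face.
  rewrite stokes /P; under eq_bigr do rewrite pb /cell_boundary.
  have /set0Pn/negbTE An0 : exists p, p \in A by exists pq; rewrite inE.
  under eq_bigr do rewrite An0 big_distrl /=.
  rewrite exchange_big; apply: eq_bigr => p _; rewrite -big_split /=.
  by apply: eq_bigr => t _; rewrite andb_addl.
rewrite exchange_big /=.
pose Q p v := [forall r, (r != p) ==> on_face q.+1 r v].
have faceQ p v : p \in A -> face_cell q.+1 v = Q p v && (v p < N).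
  rewrite inE => pq'; apply/forallP/andP => [fv|[/forallP fQ vp] r].
    by split; [apply/forallP => r; rewrite fv implybT|have := fv p; rewrite /on_face pq'].
  by have := fQ r; case: (eqVneq r p) => // -> _; rewrite /on_face pq'.
have Qsupp p v t : p \in A -> Q p v -> phi v (A :\ p) t ->
    #|t| = q.+1 /\ forall w, w \in t -> pos w p = v p.
  move=> pA /forallP fQ; have vAp : valid v (A :\ p).
    move=> r; rewrite !inE => /andP[rp rq]; have := fQ r.
    by rewrite rp /on_face rq.
  have [pc _] := phiP vAp => /pc[ct _ st]; split.
    by rewrite ct -[q.+1](card_face qD) -/A (cardsD1 p A) pA.
  by move=> w /(subsetP st) wc; apply: (cube_pos wc); rewrite !inE eqxx.
have P0 p v : p \in A -> Q p v -> v p = 0 :> nat -> P v p = false.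
  move=> pA fQ vp; apply: big1 => t _; apply/negP => /andP[/(Qsupp _ _ _ pA fQ)[_ tp]].
  case/asboolP => l cl; have ap w : w \in t -> (0 < a w p)%R.
    by move=> wt; rewrite a_pos // tp.
  have := conic_sum_gt0 cl ap; have: p < q.+1 by move: pA; rewrite inE.
  rewrite ltnS leq_eqVlt => /predU1P[-> h|pq' h].
    by rewrite ltNge ltW.
  by case: cl h => _ _ _ /(_ p pq')->; rewrite ltxx.
have PN p v : p \in A -> p != pq -> Q p v -> v p = N :> nat -> P v p = false.
  move=> pA ppq fQ vp; apply: big1 => t _; apply/negP => /andP[/(Qsupp _ _ _ pA fQ)[_ tp]].
  case/asboolP => l cl; have ap w : w \in t -> (a w p < 0)%R.
    by move=> wt; rewrite a_neg // tp.
  have := conic_sum_lt0 cl ap; have: p < q.+1 by move: pA; rewrite inE.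
  rewrite (ltq _ ppq) => pq' h.
  by case: cl h => _ _ _ /(_ p pq')->; rewrite ltxx.
(* Along each grid line in direction [p] the inner facets occur twice and cancel; the facet at 0
   contributes nothing by [P0], which leaves the facet at [N]. *)
have tele p : p \in A ->
    \big[addb/false]_(v | face_cell q.+1 v) (P v p (+) P (shift p v) p) =
    \big[addb/false]_(v | Q p v && (v p == N :> nat)) P v p.
  move=> pA; rewrite big_split /=.
  have -> : \big[addb/false]_(v | face_cell q.+1 v) P (shift p v) p =
      \big[addb/false]_(v | Q p v) P v p.
    rewrite [RHS](bigID (fun v : G => 0 < v p)) /= [X in _ = _ (+) X]big1 => [|v]; last first.
      by case/andP=> fQ; rewrite -eqn0Ngt => /eqP; apply: P0.
    rewrite addbF.
    pose unshift (v : G) : G := [ffun i => if i == p then inord (v i).-1 else v i].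
    have unE (v : G) : 0 < v p -> unshift v p = (v p).-1 :> nat.
      by move=> vp; rewrite ffunE eqxx inordK // prednK // ltnW // ltn_ord.
    have Qs (v v' : G) : (forall r, r != p -> v r = v' r) -> Q p v = Q p v'.
      by move=> e; apply: eq_forallb => r; case: eqVneq => //= rp; rewrite /on_face e.
    rewrite [RHS](reindex_onto (shift p) unshift) /=.
      apply: eq_bigl => v; rewrite (faceQ _ _ pA).
      rewrite (Qs (shift p v) v); last by move=> r rp; rewrite shift_neq.
      case: (Q p v) => //=; have [vN|vN] := ltnP (v p) N.
        rewrite (shiftE vN); apply/esym/eqP/ffunP => i; rewrite /unshift ffunE.
        have [->|ip] := eqVneq i p; last by rewrite shift_neq.
        by apply: val_inj; rewrite /= (shiftE vN) /= inordK.
      (* Where [v p = N], the default value of [inord] sends the shifted coordinate to 0, so both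
         sides are false. *)
      rewrite ffunE eqxx; have -> : v p = N :> nat by apply/eqP; rewrite eqn_leq vN -ltnS ltn_ord.
      by rewrite /inord val_insubd ltnn.
    move=> v /andP[_ vp]; apply/ffunP => i; rewrite ffunE.
    have [->|ip] := eqVneq i p; last by rewrite /unshift ffunE (negPf ip).
    by apply: val_inj; rewrite /= unE // inordK prednK // ltn_ord.
  rewrite [X in _ (+) X](bigID (fun v : G => v p < N)) /=.
  rewrite (eq_bigl _ _ (fun v => faceQ p v pA)).
  rewrite addbA addbb /=; apply: eq_bigl => v; rewrite -leqNgt eqn_leq.
  by rewrite -[v p <= N]ltnS ltn_ord.
rewrite (eq_bigr _ tele) (bigD1 pq) /=; last by rewrite inE.
rewrite [X in _ (+) X]big1 => [|p /andP[pA ppq]]; last first.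
  by apply: big1 => v /andP[fQ /eqP vN]; apply: PN.
rewrite addbF; apply: eq_big => [v|v /andP[fQ /eqP vN]].
  rewrite /face_cell; apply/andP/forallP => [[/forallP fQ vN] r|fv].
    have := fQ r; have [->|rp /=] := eqVneq r pq; first by rewrite /on_face ltnn.
    by rewrite /on_face ltq.
  split; last by have := fv pq; rewrite /on_face ltnn.
  apply/forallP => r; apply/implyP => rp; have := fv r.
  by rewrite /on_face ltq.
(* On this facet all labels have negative coordinate [q], so meeting the ray amounts to killing the
   first [q] coordinates. *)
apply: eq_bigr => t _; rewrite face_rem; case e: (phi v _ t) => //=.
have pqA : pq \in A by rewrite inE.
have [|ct tp] := Qsupp pq v t pqA fQ; first by rewrite face_rem.
apply/asboolP/asboolP => -[l cl]; first by exists l.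
exists l => //; apply: conic_sum_lt0 cl _ => w wt.
by apply: (a_neg (p := pq)); rewrite tp.
Qed.

(** At [q = 0] the face is one corner, whose chain has the empty simplex as boundary and hence an
    odd number of vertices; [flag_step] keeps the parity. *)
Lemma flag_count q : q <= D ->
  \big[addb/false]_(v | face_cell q v) \big[addb/false]_s (phi v (face q) s && origin_in_hull a q s) = true.
Proof.
elim: q => [|q IH] qD; last by rewrite flag_step // IH // ltnW.
have -> : face 0 = set0 by apply/setP => p; rewrite !inE.
pose vN : G := [ffun=> ord_max].
rewrite (big_pred1 vN) => [|v]; last first.
  apply/forallP/eqP => [fv|-> p]; last by rewrite /on_face ffunE ltn0.
  by apply/ffunP => p; rewrite ffunE; apply: val_inj; apply/eqP; have := fv p.
have vV : valid vN set0 by move=> p; rewrite inE.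
have [pc pb] := phiP vV.
have -> : \big[addb/false]_s (phi vN set0 s && origin_in_hull a 0 s) =
   \big[addb/false]_s (phi vN set0 s && \big[addb/false]_(w in s) (s :\ w == set0)).
  apply: eq_bigr => s _; case e: (phi vN set0 s) => //=.
  have [/eqP cs _ _] := pc s e; move: cs; rewrite cards0 => /cards1P[w ->].
  rewrite big_set1 setDv eqxx; apply/asboolP; exists (fun v => (v == w)%:R%R); split=> //.
  - by move=> v; rewrite inE => /negPf->.
  - by exists w; rewrite eqxx oner_neq0.
rewrite (stokes (fun t => t == set0)) (bigD1 set0) //= big1 => [|t /negPf->]; last by rewrite andbF.
by rewrite pb /cell_boundary !eqxx.
Qed.
End Degree.

Section RainbowPoincareMiranda.
Set Implicit Arguments. Unset Strict Implicit.
Import Order.TTheory GRing.Theory Num.Theory.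

Theorem strict_rainbow_poincare_miranda (F : realFieldType) (D N : nat) (W C : finType)
    (pos : W -> {ffun 'I_D -> 'I_N.+1}) (pl : W -> C) (a : W -> nat -> F) :
  (forall v, D < #|pl @: [set w | pos w == v]|) -> generic a D ->
  (forall w (p : 'I_D), pos w p = 0 :> nat -> (0 < a w p)%R) ->
  (forall w (p : 'I_D), pos w p = N :> nat -> (a w p < 0)%R) ->
  exists v s l, [/\ rainbow pl s, s \subset cube pos v setT & conic a s D l].
Proof.
move=> hpl gen ap an; have [phi phiP0] := rainbow_chain_map hpl (leqnn D.+1).
have phiP v A : valid v A ->
    chain_in pl #|A|.+1 (cube pos v A) (phi v A) /\ boundary (phi v A) =1 cell_boundary phi v A.
  by move=> vA; apply: phiP0 => //; rewrite ltnS -[D in _ <= D]card_ord max_card.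
have := flag_count gen ap an phiP (leqnn D).
case/idP/big_addb_true=> v fv /big_addb_true[s _ /andP[ps /asboolP[l cl]]].
have fT : face D D = setT by apply/setP => p; rewrite !inE ltn_ord.
have vT : valid v setT.
  by move=> p _; have /forallP/(_ p) := fv; rewrite /on_face ltn_ord.
exists v, s, l; have [pc _] := phiP v setT vT; rewrite fT in ps.
by have [_ rs ss] := pc s ps; split.
Qed.
End RainbowPoincareMiranda.

(** * From generic labels and strict signs to arbitrary labels and weak signs *)

Section Perturbation.
Set Implicit Arguments. Unset Strict Implicit.
Import Order.TTheory GRing.Theory Num.Theory.
Local Open Scope ring_scope.

(* The minors are polynomials in [y] that at [y = 0] are Vandermonde determinants. *)
Lemma generic_perturbation (F : realFieldType) (W : finType) (z : W -> nat -> F) (e : W -> F) D (M : F) :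
  injective e -> exists2 y, M < y & generic (fun w p => y * z w p + e w ^+ p) D.
Proof.
move=> inj_e.
pose A (s : {set W}) : 'M[{poly F}]_#|s| :=
  \matrix_(i, j) ((z (enum_val i) j)%:P * 'X + (e (enum_val i) ^+ j)%:P).
pose P := \prod_(s : {set W}) \det (A s).
have hornerA y s : (\det (A s)).[y] = \det (\matrix_(i < #|s|, j < #|s|)
    (y * z (enum_val i) j + e (enum_val i) ^+ j)).
  rewrite -horner_evalE -det_map_mx; congr (\det _); apply/matrixP => i j.
  by rewrite !mxE /= horner_evalE !hornerE mulrC.
have P0 : P != 0.
  apply/prodf_neq0 => s _; apply/eqP => /(congr1 (horner^~ 0)) /eqP.
  rewrite hornerA horner0; apply/negP.
  have -> : \matrix_(i < #|s|, j < #|s|) (0 * z (enum_val i) j + e (enum_val i) ^+ j) =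
      (Vandermonde #|s| (\row_j e (enum_val j)))^T.
    by apply/matrixP => i j; rewrite !mxE mul0r add0r.
  rewrite det_tr det_Vandermonde; apply/prodf_neq0 => i _; apply/prodf_neq0 => j ij.
  rewrite !mxE subr_eq0; apply: contraTneq ij => /inj_e/enum_val_inj->.
  by rewrite ltnn.
have [y My Py] : exists2 y, M < y & ~~ root P y.
  apply: contrapT => nroot.
  (* These are [size P] distinct candidates above [M], more than [P] has roots. *)
  pose rs := [seq M + k.+1%:R | k <- iota 0 (size P)].
  have : (size rs < size P)%N.
    apply: max_poly_roots => //.
      apply/allP => _ /mapP[k _ ->]; apply/negPn/negP => nr; apply: nroot.
      by exists (M + k.+1%:R) => //; rewrite ltrDl ltr0n.
    rewrite map_inj_uniq ?iota_uniq // => k k' /addrI /eqP.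
    by rewrite eqr_nat eqSS => /eqP.
  by rewrite size_map size_iota ltnn.
exists y => // q s l _ <- sl kl w.
have detN0 : \det (\matrix_(i < #|s|, j < #|s|)
    (y * z (enum_val i) j + e (enum_val i) ^+ j)) != 0.
  rewrite -hornerA; apply: contra Py; rewrite /root /P horner_prod => /eqP d0.
  by rewrite (bigD1 s) //= d0 mul0r.
have [ws|/sl//] := boolP (w \in s).
pose u : 'rV_#|s| := \row_i l (enum_val i).
suff u0 : u = 0 by move/rowP/(_ (enum_rank_in ws w)): u0; rewrite !mxE enum_rankK_in.
move: detN0; rewrite -unitfE -/(_ \in unitmx) => uA.
apply: (can_inj (mulmxK uA)); rewrite mul0mx; apply/rowP => j; rewrite !mxE.
rewrite -[RHS](kl j (ltn_ord j)) [RHS](bigID (mem s)) /= [X in _ = _ + X]big1 ?addr0; last first.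
  by move=> v /sl->; rewrite mul0r.
by rewrite [RHS]big_enum_val; apply: eq_bigr => i _; rewrite !mxE.
Qed.

(** The labels are perturbed to [y * (K * z + b) + e ^ p]: [b] makes the boundary signs strict, the
    powers give genericity and [y] dominates them. Divided by [y], the correction is at most
    [N + 1], so [K = (N + 1) / eta] bounds the error by [eta]. *)
Theorem rainbow_poincare_miranda (I W C : finType) (N : nat)
    (pos : W -> {ffun I -> 'I_N.+1}) (pl : W -> C) (z : W -> I -> rat) (eta : rat) :
  (0 < N)%N -> (forall v, #|I| < #|pl @: [set w | pos w == v]|)%N ->
  (forall w i, pos w i = 0%N :> nat -> 0 <= z w i) ->
  (forall w i, pos w i = N :> nat -> z w i <= 0) -> 0 < eta ->
  exists (s : {set W}) (l : W -> rat), [/\ {in s &, injective pl},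
    forall w w' i, w \in s -> w' \in s -> (pos w i <= (pos w' i).+1)%N,
    forall w, 0 <= l w, forall w, w \notin s -> l w = 0 &
    \sum_w l w = 1 /\ forall i, `|\sum_w l w * z w i| <= eta].
Proof.
move=> N0 hpl z0 zN eta0; set D := #|I|.
pose pos' w : {ffun 'I_D -> 'I_N.+1} := [ffun p => pos w (enum_val p)].
pose K : rat := N.+1%:R / eta.
have K0 : 0 < K by rewrite divr_gt0 // ltr0n.
pose b w i : rat := N%:R - 2 * (pos w i)%:R.
pose z1 w (p : nat) := if insub p is Some p' then K * z w (@enum_val I I p') + b w (enum_val p') else 0.
pose e (w : W) : rat := (enum_rank w).+1%:R.
have inj_e : injective e.
  by move=> w w' /eqP; rewrite eqr_nat eqSS => /eqP/val_inj/enum_rank_inj.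
have [y My gen] := generic_perturbation z1 D ((#|W|.+1)%:R ^+ D) inj_e.
have eM w (p : 'I_D) : 0 <= e w ^+ p < y.
  rewrite exprn_ge0 ?ler0n //=; apply: le_lt_trans My.
  apply: (@le_trans _ _ (#|W|.+1%:R ^+ p)).
    by rewrite lerXn2r ?nnegrE ?ler0n // ler_nat ltnS ltnW.
  by rewrite ler_weXn2l ?ler1n // ltnW.
have y0 : 0 < y by apply: lt_trans My; rewrite exprn_gt0.
have z1E w (p : 'I_D) : z1 w p = K * z w (enum_val p) + b w (enum_val p).
  by rewrite /z1 valK.
have bN w i : `|b w i| <= N%:R.
  rewrite /b; have := ltn_ord (pos w i); rewrite ltnS -(ler_nat rat) => h1.
  have h0 : 0 <= (pos w i)%:R :> rat by rewrite ler0n.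
  by rewrite ler_norml; apply/andP; split; lra.
have N1 : 1 <= N%:R :> rat by rewrite ler1n.
have [|||v [s [l [rs ss [l0 sl [w0 lw0] kl]]]]] :=
    strict_rainbow_poincare_miranda (pos := pos') (pl := pl) _ gen.
- move=> v; pose v' := [ffun i => v (enum_rank i)].
  apply: leq_trans (hpl v') _; apply: subset_leq_card; apply: imsetS.
  apply/subsetP => w; rewrite !inE => /eqP pw; apply/eqP/ffunP => p.
  by rewrite ffunE pw ffunE enum_valK.
- move=> w p; rewrite ffunE => pw; rewrite z1E /b pw mulr0 subr0.
  have /andP[e0 _] := eM w p; rewrite ltr_wpDr // mulr_gt0 //.
  by apply: ltr_wpDl; [rewrite mulr_ge0 ?z0 // ltW|rewrite ltr0n].
- move=> w p; rewrite ffunE => pw; rewrite z1E /b pw.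
  have /andP[_ ey] := eM w p; have := zN _ _ pw.
  move: (z w _) (e w ^+ p) ey => Z E ey Z0.
  have : K * Z <= 0 by rewrite mulr_ge0_le0 // ltW.
  move: (K * Z) => T T0; have : y * (T + (N%:R - 2 * N%:R)) <= y * (-1).
    by rewrite ler_pM2l //; lra.
  lra.
have L0 : 0 < \sum_w l w.
  rewrite (bigD1 w0) //= ltr_wpDr ?sumr_ge0 // lt_def lw0; exact: l0.
pose L := \sum_w l w; pose l' w := l w / L.
have l'0 w : 0 <= l' w by rewrite divr_ge0 // ltW.
have l'1 : \sum_w l' w = 1 by rewrite -mulr_suml divff // gt_eqF.
exists s, l'; split=> //.
- move=> w w' i /(subsetP ss); rewrite inE => /forallP/(_ (enum_rank i)).
  move=> h /(subsetP ss); rewrite inE => /forallP/(_ (enum_rank i)).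
  move: h; rewrite inE !ffunE enum_rankK addn1 => /andP[_ h1] /andP[h2 _].
  exact: leq_trans h1 _.
- by move=> w /sl lw; rewrite /l' lw mul0r.
split=> // i; pose p := enum_rank i.
have := kl p (ltn_ord p).
have -> : \sum_w l w * (y * z1 w p + e w ^+ p) =
    L * (y * K * \sum_w l' w * z w i + \sum_w l' w * (y * b w i + e w ^+ p)).
  rewrite mulrDr !mulr_sumr -big_split /=; apply: eq_bigr => w _.
  rewrite z1E enum_rankK /l'; field; exact: lt0r_neq0.
move/eqP; rewrite mulf_eq0 gt_eqF //= => /eqP.
set Z := \sum_w l' w * z w i; set R := \sum_w _ => ZR.
have Rle : `|R| <= y * N.+1%:R.
  have -> : y * N.+1%:R = \sum_w l' w * (y * N.+1%:R) by rewrite -mulr_suml l'1 mul1r.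
  apply: le_trans (ler_norm_sum _ _ _) _.
  apply: ler_sum => w _; rewrite normrM ger0_norm // ler_wpM2l //.
  apply: le_trans (ler_normD _ _) _; rewrite normrM (gtr0_norm y0).
  have /andP[e0 ey] := eM w p; rewrite (ger0_norm e0) -natr1 mulrDr mulr1.
  by rewrite lerD // ?(ltW ey) // ler_pM2l.
have : y * K * `|Z| <= y * N.+1%:R.
  rewrite -(gtr0_norm (mulr_gt0 y0 K0)) -normrM.
  by have -> : y * K * Z = - R by [apply/eqP; rewrite -addr_eq0 ZR]; rewrite normrN.
by rewrite -mulrA ler_pM2l // -ler_pdivlMl // mulrC /K invf_div mulrCA divff ?mulr1 // pnatr_eq0.
Qed.
End Perturbation.

(** * Matchings in partite hypergraphs *)

Section Matching.
Set Implicit Arguments. Unset Strict Implicit.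
Import Order.TTheory GRing.Theory Num.Theory.
Local Open Scope ring_scope.
Variables (F : realFieldType) (E : finType) (d m : nat) (t : E -> 'I_d -> 'I_m).
Hypothesis d_gt1 : (1 < d)%N.
Let V := ('I_d * 'I_m)%type.
Implicit Types (y z : E -> F) (e f : E) (v : V).

(** A vertex is a pair of a part and an element of it, here a cake and a piece. Edges are indexed by
    [E], so that one tuple can occur for several players. *)
Definition inc v e : F := (t e v.1 == v.2)%:R.
Definition load y v := \sum_e inc v e * y e.
Definition supp y := [set e | y e != 0].
Definition tight y := [set v | load y v == 1].
Let c : F := (d - 1)%:R.

Let c_gt0 : 0 < c. Proof. by rewrite ltr0n subn_gt0. Qed.

Let k0 := Ordinal (ltnW d_gt1).
Let k1 := Ordinal d_gt1.

Lemma loadD a y z v : load (fun e => y e + a * z e) v = load y v + a * load z v.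
Proof.
by rewrite /load mulr_sumr -big_split; apply: eq_bigr => e _; rewrite mulrDr mulrCA.
Qed.

(** At most [d - 1] weights, each below [1/(d-1)], cannot add up to 1. *)
Lemma tight_degree y v : (forall e, 0 <= y e) -> (forall e, y e < c^-1) -> v \in tight y ->
  (d <= #|[set e in supp y | t e v.1 == v.2]|)%N.
Proof.
move=> y0 yc; rewrite inE => /eqP lv; set S := [set e in _ | _].
have lS : load y v = \sum_(e in S) y e.
  rewrite /load [RHS]big_mkcond; apply: eq_bigr => e _; rewrite /inc !inE.
  by case: (y e =P 0) => [->|_] /=; rewrite ?mulr0 //; case: (_ == _); rewrite ?mul1r ?mul0r.
have : 1 < #|S|%:R * c^-1.
  have [e0 e0S] : exists e, e \in S.
    apply/set0Pn/eqP => S0; move: lS; rewrite S0 big_set0 lv => /eqP; by rewrite oner_eq0.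
  rewrite mulr_natl -sumr_const -[X in X < _]lv lS.
  apply: ltr_sum => [|e _]; last exact: yc.
  by apply/hasP; exists e0; rewrite ?mem_index_enum.
rewrite ltr_pdivlMr // mul1r ltr_nat; lia.
Qed.

(* If no weight reaches 1/(d-1), every tight vertex has degree at least [d], so there are at most as many
   tight vertices as edges; in case of equality the tight constraints are dependent. *)
Lemma tight_kernel y : (forall e, 0 <= y e) -> (forall e, y e < c^-1) ->
    (exists e, y e != 0) ->
  exists z, [/\ forall e, y e = 0 -> z e = 0, exists e, z e != 0 &
    forall v, v \in tight y -> load z v = 0].
Proof.
move=> y0 yc [e0 ye0]; set T := tight y; set S := supp y.
have e0S : e0 \in S by rewrite inE.
pose cnt e := #|[set k | (k, t e k) \in T]|.
have cntd e : (cnt e <= d)%N by rewrite -[d in (_ <= d)%N]card_ord max_card.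
have dbl : (\sum_(v in T) #|[set e in S | t e v.1 == v.2]| = \sum_(e in S) cnt e)%N.
  under eq_bigr do rewrite -sum1_card.
  rewrite (exchange_big_dep (mem S)) /=; last by move=> v e _; rewrite inE => /andP[].
  apply: eq_bigr => e eS; rewrite /cnt -sum1_card.
  rewrite (reindex_onto (fun k => (k, t e k)) fst) /=; last first.
    by case=> k j /= /andP[_]; rewrite !inE /= => /andP[_ /eqP->].
  by move: eS; rewrite inE => eS; apply: eq_bigl => k; rewrite !inE /= !eqxx eS !andbT.
have degT : (d * #|T| <= \sum_(v in T) #|[set e in S | t e v.1 == v.2]|)%N.
  by rewrite mulnC -sum_nat_const; apply: leq_sum => v; apply: tight_degree.
have degS : (\sum_(e in S) cnt e <= d * #|S|)%N.
  by rewrite mulnC -sum_nat_const; apply: leq_sum.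
have leTS : (#|T| <= #|S|)%N.
  by rewrite -(leq_pmul2l (ltnW d_gt1)) (leq_trans degT) // dbl.
have kern (T' : {set V}) : (#|T'| < #|S|)%N -> exists z, [/\ forall e, y e = 0 -> z e = 0,
    exists e, z e != 0 & forall v, v \in T' -> load z v = 0].
  move=> /(@linear_dependency F E V S T' inc)[z [sz nz kz]]; exists z; split=> //.
  by move=> e ye; apply: sz; rewrite inE ye eqxx.
have [ltTS|geTS] := ltnP #|T| #|S|; first exact: kern.
(* Equality in the double count forces every vertex of every support edge to be tight. *)
have full e k : e \in S -> (k, t e k) \in T.
  move=> eS; have : cnt e = d.
    apply/eqP; rewrite eqn_leq cntd leqNgt; apply/negP => lt_cnt.
    have : (\sum_(e in S) cnt e < d * #|S|)%N.
      rewrite mulnC -sum_nat_const (bigD1 e) //= [X in (_ < X)%N](bigD1 e) //=.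
      by rewrite -addSn leq_add // leq_sum.
    rewrite -dbl ltnNge => /negP; apply; apply: leq_trans degT.
    by rewrite leq_pmul2l // ltnW.
  move=> cd; have /setP/(_ k) : [set k | (k, t e k) \in T] = setT.
    by apply/eqP; rewrite eqEcard subsetT cardsT card_ord -/(cnt e) cd leqnn.
  by rewrite !inE.
pose v0 : V := (k0, t e0 k0).
have v0T : v0 \in T by apply: full.
have [|z [sz nz kz]] := kern (T :\ v0).
  by rewrite (leq_trans _ leTS) // (cardsD1 v0 T) v0T.
exists z; split=> // v vT; have [{v vT}->|vv0] := eqVneq v v0; last first.
  by apply: kz; rewrite in_setD1 vv0.
(* Each part of the tight vertices meets every edge exactly once, so both parts carry total load [\sum_e z e]. *)
have part k : \sum_(v in T | v.1 == k) load z v = \sum_e z e.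
  rewrite exchange_big; apply: eq_bigr => e _ /=; rewrite -mulr_suml.
  have [/sz->|ye] := eqVneq (y e) 0; first by rewrite mulr0.
  rewrite (bigD1 (k, t e k)) /=; last by rewrite full ?inE //= eqxx.
  rewrite big1 ?addr0 /inc /= ?eqxx ?mul1r // => -[k' j] /= /andP[/andP[_ /eqP->]].
  by rewrite xpair_eqE eqxx /= eq_sym => /negPf->.
rewrite -[RHS](_ : \sum_(v in T | v.1 == k1) load z v = 0); last first.
  apply: big1 => -[k j] /andP[vT /eqP/= kk1]; apply: kz; rewrite in_setD1 vT andbT.
  by rewrite xpair_eqE kk1.
rewrite part -(part k0) (bigD1 v0) /=; last by rewrite v0T eqxx.
rewrite big1 ?addr0 // => v /andP[/andP[vT _] vv0]; apply: kz.
by rewrite in_setD1 vv0.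
Qed.

(* Furedi's argument: an edge of weight at least 1/(d-1) meets edges of total weight at most [d - 1], so
   it can be chosen and its neighbours deleted; otherwise move along a kernel vector. *)
Theorem partite_matching y : (forall e, 0 <= y e) -> (forall v, load y v <= 1) ->
  exists M : {set E}, [/\ forall e, e \in M -> y e != 0,
    forall e f, e \in M -> f \in M -> e != f -> forall k, t e k != t f k &
    \sum_e y e <= c * #|M|%:R].
Proof.
(* The measure is lexicographic: first the support size, then the number of vertices that are not
   tight. The latter is at most [#|V|], whence the factor. *)
have [n] := ubnP (#|supp y| * #|{: V}|.+1 + #|~: tight y|); elim: n y => // n IH y yn y0 l1.
have [[e0 ye0]|yz] := pselect (exists e, y e != 0); last first.
  exists set0; split=> [e|e f|]; rewrite ?inE // cards0 mulr0.
  rewrite big1 // => e _; apply/eqP/negPn/negP => ye; apply: yz; by exists e.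
have [[e ye]|nge] := pselect (exists e, c^-1 <= y e).
  have ye_gt0 : 0 < y e by apply: lt_le_trans ye; rewrite invr_gt0.
  pose meets f := [exists k, t f k == t e k].
  have ee : meets e by apply/existsP; exists k0.
  pose y' f := if meets f then 0 else y f.
  have y'0 f : 0 <= y' f by rewrite /y'; case: ifP.
  have y'y f : y' f <= y f by rewrite /y'; case: ifP.
  have [|v|M [My Mdis Mc]] := IH y' _ y'0.
  - rewrite -ltnS (leq_trans _ yn) // ltnS.
    have lts : (#|supp y'| < #|supp y|)%N.
      apply: proper_card; apply/properP; split.
        by apply/subsetP => f; rewrite !inE /y'; case: ifP; rewrite // eqxx.
      by exists e; rewrite !inE; [rewrite gt_eqF|rewrite /y' ee eqxx].
    have ltV : (#|~: tight y'| <= #|{: V}|)%N by apply: max_card.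
    nia.
  - apply: le_trans (l1 v); apply: ler_sum => f _; rewrite ler_wpM2l // /inc; exact: ler0n.
  have Mmeets f : f \in M -> ~~ meets f.
    by move=> /My; rewrite /y'; case: (meets f); rewrite // eqxx.
  have eM : e \notin M by apply/negP => /Mmeets; rewrite ee.
  exists (e |: M); split.
  - move=> f /setU1P[->|fM]; first by rewrite gt_eqF.
    by have := My f fM; rewrite /y' (negPf (Mmeets f fM)).
  - move=> f g /setU1P[->|fM] /setU1P[->|gM]; rewrite ?eqxx //; last exact: Mdis.
      by move=> _ k; rewrite eq_sym; apply: contraNneq (Mmeets g gM) => h; apply/existsP; exists k; apply/eqP.
    by move=> _ k; apply: contraNneq (Mmeets f fM) => h; apply/existsP; exists k; apply/eqP.
  rewrite cardsU1 eM natrD mulrDr mulr1.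
  have -> : \sum_f y f = \sum_f (if meets f then y f else 0) + \sum_f y' f.
    by rewrite -big_split; apply: eq_bigr => f _; rewrite /y' /=; case: ifP; rewrite ?addr0 ?add0r.
  apply: lerD => //.
  (* Adding the loads of the [d] vertices of [e] counts [e] itself [d] times and every other edge
     meeting [e] at least once. *)
  have : \sum_f (if meets f then y f else 0) + c * y e <= d%:R.
    apply: (@le_trans _ _ (\sum_k load y (k, t e k))); last first.
      apply: (@le_trans _ _ (\sum_(k < d) 1)); first by apply: ler_sum.
      by rewrite sumr_const card_ord.
    rewrite exchange_big (bigD1 e) //= [X in _ <= X](bigD1 e) //= ee addrAC lerD //.
      rewrite -mulr_suml (eq_bigr (fun=> 1)); last by move=> k _; rewrite /inc eqxx.
      rewrite sumr_const card_ord.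
      have -> : y e + c * y e = (1 + c) * y e by rewrite mulrDl mul1r.
      by rewrite ler_wpM2r // /c nat1r ler_nat; lia.
    apply: ler_sum => f fe; rewrite -mulr_suml; case: ifP => [/existsP[k tk]|_]; last first.
      by rewrite mulr_ge0 // sumr_ge0 // => k _; rewrite ler0n.
    rewrite -[X in X <= _]mul1r ler_wpM2r // (bigD1 k) //= {1}/inc tk lerDl.
    by rewrite sumr_ge0 // => j _; rewrite ler0n.
  have : 1 <= c * y e by rewrite mulrC -ler_pdivrMr // mul1r.
  have -> : d%:R = c + 1 by rewrite /c natr1; congr _%:R; lia.
  lra.
have yc e : y e < c^-1 by rewrite ltNge; apply/negP => h; apply: nge; exists e.
have [|z [sz nz kz]] := tight_kernel y0 yc; first by exists e0.
(* Up to replacing [z] by its opposite, moving along [z] does not lower the total weight. *)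
wlog zs : z sz nz kz / 0 <= \sum_e z e.
  move=> wl; have [|zneg] := leP 0 (\sum_e z e); first exact: wl.
  apply: (wl (fun e => - z e)).
  - by move=> e /sz->; rewrite oppr0.
  - by case: nz => e ze; exists e; rewrite oppr_eq0.
  - move=> v /kz; rewrite /load; under [in X in _ -> X]eq_bigr do rewrite mulrN.
    by rewrite sumrN => ->; rewrite oppr0.
  - by rewrite sumrN oppr_ge0 ltW.
(* Edge weights and vertex slacks form one vector: the ratio test stops when an edge weight reaches
   zero or a further vertex becomes tight, and either lowers the measure. *)
pose alpha (x : E + V) := match x with inl e => y e | inr v => 1 - load y v end.
pose beta (x : E + V) := match x with inl e => z e | inr v => - load z v end.
have [|||a [a0 ab [x [bx abx]]]] := @ratio_test F (E + V)%type alpha beta.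
- by case=> [e|v] /=; rewrite ?subr_ge0.
- case=> [e /= /sz-> //|v /= /eqP]; rewrite subr_eq0 eq_sym => lv.
  by rewrite kz ?oppr0 // inE.
- have [[e ze]|zn] := pselect (exists e, z e < 0); first by exists (inl e).
  case: nz => e ze; exists (inr (k0, t e k0)); rewrite /= oppr_lt0.
  have zp f : 0 <= z f by rewrite leNgt; apply/negP => h; apply: zn; exists f.
  rewrite /load (bigD1 e) //= ltr_wpDr //.
    by apply: sumr_ge0 => f _; rewrite mulr_ge0 // ler0n.
  by rewrite /inc eqxx mul1r lt_def ze zp.
pose y' e := y e + a * z e.
have lE v : load y' v = load y v + a * load z v by apply: loadD.
have y'0 e : 0 <= y' e := ab (inl e).
have sy : supp y' \subset supp y.
  by apply/subsetP => e; rewrite !inE; apply: contraNneq => ye; rewrite /y' ye (sz e ye) mulr0 addr0.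
have st : ~: tight y' \subset ~: tight y.
  apply/subsetP => v; rewrite !inE; apply: contraNneq => lv.
  by rewrite lE kz ?inE ?lv // mulr0 addr0.
have [|v|M [My Mdis Mc]] := IH y' _ y'0.
- rewrite -ltnS (leq_trans _ yn) // ltnS.
  have ls := subset_leq_card sy; have lt := subset_leq_card st.
  case: x bx abx => [e|v] /= bx abx.
    have lts : (#|supp y'| < #|supp y|)%N.
      apply: proper_card; apply/properP; split=> //; exists e; rewrite !inE.
        by apply: contraTneq bx => /sz->; rewrite ltxx.
      by rewrite /y' abx eqxx.
    by rewrite -addSn leq_add // ltn_pmul2r.
  have ltt : (#|~: tight y'| < #|~: tight y|)%N.
    apply: proper_card; apply/properP; split=> //; exists v; rewrite !inE.
      by apply: contraTneq bx => lv; rewrite kz ?oppr0 ?ltxx // inE lv.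
    by rewrite negbK lE; apply/eqP; lra.
  by rewrite -addnS leq_add // leq_pmul2r.
- by have := ab (inr v); rewrite /= lE; lra.
exists M; split=> // [e /My|].
  by apply: contraNneq => ye; rewrite /y' ye (sz e ye) mulr0 addr0.
apply: le_trans Mc; rewrite /y' big_split /= -mulr_sumr lerDl.
exact: mulr_ge0 (ltW a0) zs.
Qed.
End Matching.

(** * Cake cutting on a grid *)

Section GridMatching.
Set Implicit Arguments. Unset Strict Implicit.
Import Order.TTheory GRing.Theory Num.Theory.
Local Open Scope ring_scope.

(** [L i] stands for the load of piece [i] and [S i] for that of the pieces from [i] on. For
    [eta = 0] the relations force all loads to be [1/m]; in general the bound on [S] loses at most
    [eta] per step. *)
Lemma balanced_load (F : realFieldType) (m : nat) (S L : nat -> F) (eta : F) :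
  0 <= eta -> (forall i, S i = L i + S i.+1) -> S 0%N = 1 -> S m = 0 ->
  (forall i, (i.+1 < m)%N -> `|S i.+1 - (m - i.+1)%:R * L i| <= eta) ->
  forall i, (i < m)%N -> L i <= m%:R^-1 + m%:R * eta.
Proof.
move=> eta0 SL S0 Sm Sz.
have Sb i : (i < m)%N -> S i <= (m - i)%:R * m%:R^-1 + i%:R * eta.
  elim: i => [|i IH] im.
    by rewrite subn0 S0 divff ?mul0r ?addr0 // pnatr_eq0 -lt0n.
  have := IH (ltnW im); have := Sz i im; rewrite ler_norml => /andP[_].
  have -> : (m - i)%:R = 1 + (m - i.+1)%:R :> F by rewrite nat1r; congr _%:R; lia.
  have := SL i; have : 0 <= (m - i.+1)%:R :> F by rewrite ler0n.
  have : 0 <= i%:R :> F by rewrite ler0n.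
  rewrite -[i.+1%:R]natr1.
  move: (m - i.+1)%:R (m%:R^-1) (i%:R) (S i) (S i.+1) (L i) => a b I s s' l I0 a0 sl h1 h2.
  rewrite -(ler_pM2l (_ : 0 < 1 + a)); last by lra.
  have : a * s <= a * ((1 + a) * b + I * eta) by rewrite ler_wpM2l.
  have : 0 <= a * eta by rewrite mulr_ge0.
  have : 0 <= I * eta by rewrite mulr_ge0.
  nra.
move=> i im; have Si := Sb i im.
have m0 : 0 < m%:R :> F by rewrite ltr0n; lia.
have mi : (1 <= (m - i)%:R :> F) by rewrite ler1n; lia.
have ii : i%:R + 1 <= m%:R :> F by rewrite natr1 ler_nat.
have i0 : 0 <= i%:R :> F by rewrite ler0n.
have : (m - i)%:R * L i <= S i + eta.
  have [im1|im1] := ltnP i.+1 m.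
    have := Sz i im1; rewrite ler_norml (SL i) => /andP[h _].
    have -> : (m - i)%:R = 1 + (m - i.+1)%:R :> F by rewrite nat1r; congr _%:R; lia.
    lra.
  have -> : (m - i)%N = 1%N by lia.
  have e : i.+1 = m by lia.
  by rewrite (SL i) e Sm; lra.
move=> h; rewrite -(ler_pM2l (_ : 0 < (m - i)%:R)); last by lra.
apply: le_trans h _.
move: (m - i)%:R m%:R (m%:R^-1) (i%:R) (S i) mi ii i0 m0 Si => a M b I s a1 IM I0 M0 h.
have : 0 <= (a - 1) * (M * eta) by rewrite mulr_ge0 // ?mulr_ge0 //; lra.
have : (I + 1) * eta <= M * eta by rewrite ler_wpM2r.
nra.
Qed.

Variables (d m n N : nat).
Let G := {ffun 'I_d * 'I_(m - 1) -> 'I_N.+1}.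
Implicit Types (v : G) (k : 'I_d).

(* The running maxima of the [m - 1] coordinates of cake [k] are its cut points, in units of 1/N:
   coordinate [i] equal to 0 makes piece [i] empty and coordinate [i] equal to [N] makes
   all pieces after [i] empty. *)
Definition cut (v : G) (k : 'I_d) (j : nat) : nat :=
  if j == m then N else (\max_(i < m - 1 | (i < j)%N) v (k, i))%N.

Lemma cut0 v k : (0 < m)%N -> cut v k 0 = 0%N.
Proof. by rewrite /cut lt0n eq_sym => /negPf->; rewrite big_pred0. Qed.

Lemma cut_max v k : cut v k m = N.
Proof. by rewrite /cut eqxx. Qed.

Lemma max_cut_le v k (j : nat) : (\max_(i < m - 1 | (i < j)%N) v (k, i) <= N)%N.
Proof. by apply/bigmax_leqP => i _; rewrite -ltnS ltn_ord. Qed.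

Lemma cut_homo v k j j' : (j <= j')%N -> (j' <= m)%N -> (cut v k j <= cut v k j')%N.
Proof.
move=> jj j'm; rewrite /cut; case: (eqVneq j' m) => [_|j'N].
  by case: ifP => // _; apply: max_cut_le.
rewrite ifN; last by rewrite neq_ltn; lia.
apply/bigmax_leqP => i ij; apply: (leq_bigmax_cond (F := fun i => nat_of_ord (v (k, i)))).
exact: leq_trans ij jj.
Qed.

Lemma cut_close v v' k j : (forall p, v p <= (v' p).+1)%N -> (cut v k j <= (cut v' k j).+1)%N.
Proof.
move=> vv'; rewrite /cut; case: ifP => // _; apply/bigmax_leqP => i ij.
apply: leq_trans (vv' _) _; rewrite ltnS.
exact: (leq_bigmax_cond (F := fun i => nat_of_ord (v' (k, i)))).
Qed.

Lemma cut_coord0 v k (i : 'I_(m - 1)) : v (k, i) = 0%N :> nat -> (cut v k i.+1 <= cut v k i)%N.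
Proof.
move=> vki; have im := ltn_ord i; rewrite /cut !ifN ?neq_ltn; try lia.
apply/bigmax_leqP => i'; rewrite ltnS leq_eqVlt => /predU1P[/val_inj->|i'i]; first by rewrite vki.
exact: (leq_bigmax_cond (F := fun i => nat_of_ord (v (k, i)))).
Qed.

Lemma cut_coordN v k (i : 'I_(m - 1)) j : v (k, i) = N :> nat -> (i < j)%N -> (j < m)%N ->
  (cut v k j.+1 <= cut v k j)%N.
Proof.
move=> vki ij jm; apply: (@leq_trans N).
  by rewrite /cut; case: ifP => // _; apply: max_cut_le.
rewrite /cut ifN ?neq_ltn ?jm // -[X in (X <= _)%N]vki.
exact: (leq_bigmax_cond (F := fun i => nat_of_ord (v (k, i)))).
Qed.

Theorem grid_matching (H : G -> 'I_n -> {ffun 'I_d -> 'I_m} -> Prop) :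
  (0 < m)%N -> (1 < d)%N -> (d * (m - 1) + 1 <= n)%N -> (0 < N)%N ->
  (forall v i t, H v i t -> forall k, cut v k (t k) < cut v k (t k).+1)%N ->
  (forall v (I : {set 'I_n}), #|I| = (n - d * (m - 1))%N -> exists2 i, i \in I & exists t, H v i t) ->
  exists (S : {set 'I_n}) (alloc : {ffun 'I_n -> {ffun 'I_d -> 'I_m}}) (v : 'I_n -> G),
  [/\ (m <= (d - 1) * #|S|)%N,
    forall i j, i \in S -> j \in S -> i != j -> forall k, alloc i k != alloc j k,
    forall i, i \in S -> H (v i) i (alloc i) &
    forall i j p, i \in S -> j \in S -> (v i p <= (v j p).+1)%N].
Proof.
move=> m0 d1 nD N0 Hcut hungryH.
pose W := {x : G * 'I_n * {ffun 'I_d -> 'I_m} | `[< H x.1.1 x.1.2 x.2 >]}.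
pose pos (w : W) : G := (val w).1.1; pose pl (w : W) := (val w).1.2; pose tup (w : W) := (val w).2.
have WH (w : W) : H (pos w) (pl w) (tup w) by apply/asboolP; apply: (valP w).
pose z (w : W) (p : 'I_d * 'I_(m - 1)) : rat :=
  (p.2 < tup w p.1)%N%:R - (m - p.2.+1)%:R * (tup w p.1 == p.2 :> nat)%:R.
pose eta : rat := (m%:R ^+ 3)^-1.
have mr0 : 0 < m%:R :> rat by rewrite ltr0n.
have eta0 : 0 < eta by rewrite invr_gt0 exprn_gt0.
have [v|w [k i] /= wi|w [k i] /= wi|s [l [rs close l0 sl [l1 lz]]]] :=
  @rainbow_poincare_miranda _ W 'I_n N pos pl z eta N0 _ _ _ eta0.
(* Were at most [d * (m - 1)] players hungry at [v], the others would contain a set of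
   [n - d * (m - 1)] players with nobody hungry. *)
- set Hs := _ @: _; rewrite ltnNge; apply/negP => leH.
  rewrite card_prod !card_ord in leH.
  pose I := [set x in take (n - d * (m - 1)) (enum (~: Hs))].
  have cI : #|I| = (n - d * (m - 1))%N.
    rewrite cardsE (card_uniqP _) ?take_uniq ?enum_uniq // size_take -cardE.
    have := cardsC Hs; rewrite card_ord => cH; case: ltnP; lia.
  have [i iI [t Ht]] := hungryH v I cI.
  have : i \in ~: Hs by move: iI; rewrite inE => /mem_take; rewrite mem_enum.
  rewrite inE => /negP; apply; apply/imsetP.
  have P : `[< H (v, i, t).1.1 (v, i, t).1.2 (v, i, t).2 >] by apply/asboolP.
  by exists (exist _ (v, i, t) P : W); rewrite ?inE.
- rewrite /z /=; case: eqVneq => [e|_]; last by rewrite mulr0 subr0 ler0n.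
  by have := Hcut _ _ _ (WH w) k; rewrite e ltnNge cut_coord0.
- rewrite /z /=; case: ltnP => [lt|_]; last by rewrite sub0r oppr_le0 mulr_ge0 // ler0n.
  by have := Hcut _ _ _ (WH w) k; rewrite ltnNge (cut_coordN wi lt).
(* With [eta = 1/m^3] every load is at most [1/m + 1/m^2 = (m+1)/m^2], the inverse of [kappa]. Since
   [kappa = m - 1 + 1/(m+1)] exceeds [m - 1], integrality yields [m] in the final bound. *)
pose kappa : rat := m%:R ^+ 2 / (m%:R + 1).
have kappa0 : 0 < kappa by rewrite divr_gt0 ?exprn_gt0 // ltr_pwDr // ltW.
have load_le k (j : 'I_m) : \sum_w (tup w k == j)%:R * l w <= m%:R^-1 + m%:R * eta.
  pose S i := \sum_w (i <= tup w k)%N%:R * l w.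
  pose L (i : nat) := \sum_w (tup w k == i :> nat)%:R * l w.
  apply: (@balanced_load _ m S L eta (ltW eta0) _ _ _ _ j) => //.
  - move=> i; rewrite /S /L -big_split; apply: eq_bigr => w _ /=.
    by rewrite -mulrDl -natrD [(i <= _)%N]leq_eqVlt eq_sym; case: ltngtP.
  - by rewrite /S -[RHS]l1; apply: eq_bigr => w _; rewrite mul1r.
  - by rewrite /S big1 // => w _; rewrite leqNgt ltn_ord mul0r.
  move=> i im; have im' : (i < m - 1)%N by lia.
  have := lz (k, Ordinal im'); congr (`| _ | <= _).
  rewrite /S /L mulr_sumr -sumrB; apply: eq_bigr => w _.
  by rewrite /z /= mulrBr; congr (_ - _); [rewrite mulrC|ring].
have [|v|M [My Mdis Mc]] := @partite_matching rat W d m (fun w => tup w) d1 (fun w => kappa * l w).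
- by move=> w; rewrite mulr_ge0 // ltW.
- rewrite /load; under eq_bigr do rewrite /inc mulrCA.
  rewrite -mulr_sumr; apply: (@le_trans _ _ (kappa * (m%:R^-1 + m%:R * eta))).
    by rewrite ler_pM2l //; apply: load_le.
  rewrite le_eqVlt; apply/orP; left; apply/eqP; rewrite /kappa /eta.
  field; rewrite ?gt_eqF //=; lra.
have cM : (m <= (d - 1) * #|M|)%N.
  move: Mc; rewrite -mulr_sumr l1 mulr1 -natrM => Mc.
  have : (m - 1)%:R < kappa.
    rewrite /kappa ltr_pdivlMr; last by lra.
    have -> : m%:R = (m - 1)%:R + 1 :> rat by rewrite natr1; congr _%:R; lia.
    by nra.
  by move=> /lt_le_trans/(_ Mc); rewrite ltr_nat; lia.
have /set0Pn[w0 w0M] : M != set0.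
  by apply/negP => /eqP M0; move: cM; rewrite M0 cards0 muln0; lia.
have Ms w : w \in M -> w \in s.
  by move=> /My; apply: contraNT => /sl->; rewrite mulr0.
(* Each matched player recovers its edge, unique because [s] is rainbow; [w0] is a default for the
   other players. *)
pose rep i := odflt w0 [pick w in M | pl w == i].
have repP i : i \in pl @: M -> rep i \in M /\ pl (rep i) = i.
  case/imsetP=> w wM ->; rewrite /rep; case: pickP => [w' /andP[w'M /eqP->//]|/(_ w)].
  by rewrite wM eqxx.
exists (pl @: M), [ffun i => tup (rep i)], (fun i => pos (rep i)); split.
- by rewrite card_in_imset // => w w' wM w'M; apply: rs; apply: Ms.
- move=> i j /repP[iM pi] /repP[jM pj] ij k; rewrite !ffunE; apply: Mdis => //.
  by apply: contra_neq ij => e; rewrite -pi -pj e.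
- by move=> i /repP[iM pi]; rewrite ffunE -{2}pi.
- by move=> i j p /repP[iM _] /repP[jM _]; apply: close; apply: Ms.
Qed.
End GridMatching.

(** * Passage to the limit *)

From Stdlib Require Import Reals Lra.

Section Limits.
Set Implicit Arguments. Unset Strict Implicit.

Lemma infinite_pigeonhole (X : finType) (f : nat -> X) :
  exists x, forall M, exists2 r, (M <= r)%N & f r = x.
Proof.
apply: contrapT => nx.
have /choice[B BP] : forall x, exists M, forall r, (M <= r)%N -> f r <> x.
  move=> x; apply: contrapT => nM; apply: nx; exists x => M; apply: contrapT => nr.
  by apply: nM; exists M => r Mr fr; apply: nr; exists r.
apply: (BP _ (\max_x B x)%N _ erefl); exact: leq_bigmax.
Qed.

(** Extractions are encoded by [r <= sg r] instead of strict monotonicity; this suffices for limits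
    and is stable under composition. *)
Lemma Un_cv_subseq (u : nat -> R) (l : R) (sg : nat -> nat) :
  (forall r, (r <= sg r)%N) -> Un_cv u l -> Un_cv (fun r => u (sg r)) l.
Proof.
move=> sgr ul eps /ul[M HM]; exists M => r /leP Mr; apply: HM; apply/leP.
exact: leq_trans Mr _.
Qed.

Lemma Un_cv_inv_succ : Un_cv (fun r => / INR r.+1)%R 0.
Proof.
move=> eps /archimed_cor1[M [HM /ltP M0]]; exists M => r /leP Mr.
rewrite /R_dist Rminus_0_r Rabs_right; last first.
  by apply/Rle_ge/Rlt_le/Rinv_0_lt_compat/lt_0_INR; apply/ltP.
apply: Rle_lt_trans HM; apply: Rinv_le_contravar; first by apply/lt_0_INR; apply/ltP.
by apply/le_INR/leP; apply: leqW.
Qed.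

Lemma Un_cv_near (u v : nat -> R) (l : R) :
  (forall r, (Rabs (v r - u r) <= / INR r.+1)%R) -> Un_cv u l -> Un_cv v l.
Proof.
move=> uv ul eps e0; have e2 : (eps / 2 > 0)%R by Lra.lra.
have [M1 H1] := ul _ e2; have [M2 H2] := Un_cv_inv_succ e2.
exists (maxn M1 M2) => r /leP; rewrite geq_max => /andP[/leP r1 /leP r2].
have := H1 r r1; have := H2 r r2; have := uv r.
have inv0 : (0 < / INR r.+1)%R by apply/Rinv_0_lt_compat/lt_0_INR; apply/ltP.
rewrite /R_dist Rminus_0_r (Rabs_right (/ _)); last Lra.lra.
have -> : (v r - l = (v r - u r) + (u r - l))%R by Lra.lra.
have := Rabs_triang (v r - u r) (u r - l); Lra.lra.
Qed.

Lemma bounded_subseq (u : nat -> R) : (forall r, 0 <= u r <= 1)%R ->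
  exists sg l, (forall r, (r <= sg r)%N) /\ Un_cv (fun r => u (sg r)) l.
Proof.
move=> u01; have [l lu] := Bolzano_Weierstrass u _ (compact_P3 0 1) u01.
have /choice[sg sgP] : forall r, exists p, (r <= p)%N /\ (Rabs (u p - l) <= / INR r.+1)%R.
  move=> r; have r0 : (0 < / INR r.+1)%R by apply/Rinv_0_lt_compat/lt_0_INR; apply/ltP.
  have [|p [/leP rp up]] := lu (disc l (mkposreal _ r0)) r.
    by exists (mkposreal _ r0) => x.
  by exists p; split=> //; apply: Rlt_le.
exists sg, l; split=> [r|]; first by case: (sgP r).
apply: (@Un_cv_near (fun=> l)) => [r|eps e0]; first by case: (sgP r).
by exists 0%N => r _; rewrite R_dist_eq.
Qed.

Lemma bounded_family_subseq (J : finType) (u : nat -> J -> R) :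
  (forall r j, 0 <= u r j <= 1)%R ->
  exists sg l, (forall r, (r <= sg r)%N) /\ forall j, Un_cv (fun r => u (sg r) j) (l j).
Proof.
move=> u01.
suff [sg [l [sgr lP]]] : exists sg (l : J -> R), (forall r, (r <= sg r)%N) /\
    forall j, j \in enum J -> Un_cv (fun r => u (sg r) j) (l j).
  by exists sg, l; split=> // j; apply: lP; rewrite mem_enum.
elim: (enum J) => [|j0 s [sg [l [sgr lP]]]]; first by exists (fun r => r), (fun=> 0%R).
have [|tau [l0 [taur l0P]]] := @bounded_subseq (fun r => u (sg r) j0); first by move=> r.
exists (sg \o tau), (fun j => if j == j0 then l0 else l j); split=> [r|j].
  exact: leq_trans (taur r) (sgr _).
rewrite inE; case: eqVneq => [-> _|_ /= js]; first exact: l0P.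
exact: (@Un_cv_subseq (fun r => u (sg r) j) (l j) tau taur (lP j js)).
Qed.

Definition grid_partition d m N (v : {ffun 'I_d * 'I_(m - 1) -> 'I_N.+1}) : cake_partition d m :=
  fun k j => (INR (cut v k j) / INR N)%R.

Lemma grid_partition_valid d m N (v : {ffun 'I_d * 'I_(m - 1) -> 'I_N.+1}) :
  (0 < m)%N -> (0 < N)%N -> valid_partition (grid_partition v).
Proof.
move=> m0 N0; have NR : (0 < INR N)%R by apply/lt_0_INR/ltP.
move=> k; rewrite /grid_partition; split; [|split].
- by rewrite /= cut0 //= /Rdiv Rmult_0_l.
- by rewrite /= cut_max /Rdiv Rinv_r //; Lra.lra.
move=> j j' jj; apply: Rmult_le_compat_r; first by apply/Rlt_le/Rinv_0_lt_compat.
by apply/le_INR/leP/cut_homo; rewrite // -ltnS ltn_ord.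
Qed.

Lemma grid_piece_nonempty d m N (v : {ffun 'I_d * 'I_(m - 1) -> 'I_N.+1}) k (j : 'I_m) :
  piece_nonempty (grid_partition v) k j -> (cut v k j < cut v k j.+1)%N.
Proof.
have jm := ltn_ord j; rewrite /piece_nonempty /grid_partition !inordK //; last exact: leqW.
move=> h; rewrite ltnNge; apply/negP => /leP/le_INR h'.
apply: (Rlt_not_le _ _ h); apply: Rmult_le_compat_r => //.
have [->|N0] := posnP N; first by rewrite Rinv_0; Lra.lra.
by apply/Rlt_le/Rinv_0_lt_compat/lt_0_INR/ltP.
Qed.

Lemma grid_partition_close d m N (v v' : {ffun 'I_d * 'I_(m - 1) -> 'I_N.+1}) k j :
  (0 < N)%N -> (forall p, v p <= (v' p).+1)%N -> (forall p, v' p <= (v p).+1)%N ->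
  (Rabs (grid_partition v k j - grid_partition v' k j) <= / INR N)%R.
Proof.
move=> N0 vv' v'v; rewrite /grid_partition.
have /leP/le_INR := cut_close k j vv'; have /leP/le_INR := cut_close k j v'v.
rewrite !S_INR => h1 h2.
have NR : (0 < / INR N)%R by apply/Rinv_0_lt_compat/lt_0_INR/ltP.
have -> : (INR (cut v k j) / INR N - INR (cut v' k j) / INR N =
  (INR (cut v k j) - INR (cut v' k j)) * / INR N)%R by rewrite /Rdiv Rmult_minus_distr_r.
rewrite Rabs_mult (Rabs_right (/ _)); last Lra.lra.
rewrite -[X in (_ <= X)%R]Rmult_1_l; apply: Rmult_le_compat_r; first Lra.lra.
apply: Rabs_le; Lra.lra.
Qed.

Lemma valid_partition_lim d m (Ps : nat -> cake_partition d m) P :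
  (forall r, valid_partition (Ps r)) -> partition_cvg Ps P -> valid_partition P.
Proof.
move=> vPs PsP k.
have cst (j : 'I_m.+1) c : (forall r, Ps r k j = c) -> P k j = c.
  move=> Pc; apply: (UL_sequence _ _ _ (PsP k j)) => eps e0.
  by exists 0%N => r _; rewrite Pc R_dist_eq.
split; [|split]; try by apply: cst => r; case: (vPs r k) => ? [].
move=> j j' jj; apply: (Rle_cv_lim _ (PsP k j) (PsP k j')) => r.
by case: (vPs r k) => ? [? ]; apply.
Qed.
End Limits.

Theorem theorem1p10 (n m d : nat) (pref : preferences n d m) :
  (0 < m)%N -> (2 <= d)%N -> (d * (m - 1) + 1 <= n)%N ->
  hungry pref ->
  exists (P : cake_partition d m) (S : {set 'I_n}) (alloc : 'I_n -> dtuple d m),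
    valid_partition P /\
    (INR m / INR (d - 1) <= INR #|S|)%R /\
    (forall i j : 'I_n, i \in S -> j \in S -> i != j ->
       forall k : 'I_d, alloc i k != alloc j k) /\
    (forall i : 'I_n, i \in S -> pref i P (alloc i)).
Proof.
move=> m0 d1 nD [hungry_pref closed_pref].
(* At scale [1/(r+1)] each player still has a partition of its own, because the grid points of the
   rainbow simplex are only close to each other. *)
pose ok r (S : {set 'I_n}) (alloc : {ffun 'I_n -> {ffun 'I_d -> 'I_m}})
    (Q : 'I_n -> cake_partition d m) :=
  [/\ (m <= (d - 1) * #|S|)%N,
    forall i j, i \in S -> j \in S -> i != j -> forall k, alloc i k != alloc j k,
    forall i, valid_partition (Q i),
    forall i, i \in S -> pref i (Q i) (alloc i) &
    forall i j k x, i \in S -> j \in S -> (Rabs (Q i k x - Q j k x) <= / INR r.+1)%R].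
have /choice[f fP] : forall r, exists Sa Q, ok r Sa.1 Sa.2 Q.
  move=> r.
  have [|||S [al [v [cS dis Hp cl]]]] := @grid_matching d m n r.+1
    (fun v i t => pref i (grid_partition v) t /\ tuple_nonempty (grid_partition v) t) m0 d1 nD.
  - by [].
  - by move=> v i t [_ ne] k; apply: grid_piece_nonempty.
  - move=> v I cI; have [|i [iI [t [pt nt]]]] := hungry_pref (grid_partition v) I _ cI.
      by apply: grid_partition_valid.
    exists i => //; exists [ffun k => t k].
    by have -> : [ffun k => t k] = t :> (_ -> _) by apply: funext => k; rewrite ffunE.
  exists (S, al), (fun i => grid_partition (v i)); split=> //= [i|i /Hp[]|i j k x iS jS] //.
    exact: grid_partition_valid.
  by apply: grid_partition_close => // p; apply: cl.
(* There are finitely many pairs of a set and an allocation, so one pair recurs at arbitrarily fine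
   scales. *)
have [[S al] Sinf] := infinite_pigeonhole f.
have /choice[sg sgP] : forall r, exists p, (r <= p)%N /\ f p = (S, al).
  by move=> r; have [p] := Sinf r; exists p.
have /choice[Q QP] : forall r, exists Q, ok (sg r) S al Q.
  by move=> r; have := fP (sg r); have [_ ->] := sgP r.
have [cS dis _ _ _] := QP 0%N.
have /set0Pn[i0 i0S] : S != set0.
  by apply/negP => /eqP S0; move: cS; rewrite S0 cards0 muln0 leqNgt m0.
have Qvalid r i : valid_partition (Q r i) by have [_ _ vQ _ _] := QP r.
(* Compactness is applied to the partitions of [i0] alone; those of the other players in [S] follow
   because the mutual distances tend to 0. *)
have [|tau [l [taur lP]]] := @bounded_family_subseq ('I_d * 'I_m.+1)%type
    (fun r p => Q r i0 p.1 p.2).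
  move=> r [k j] /=; have [<- [<- mono]] := Qvalid r i0 k.
  by split; apply: mono; rewrite // -ltnS ltn_ord.
pose P : cake_partition d m := fun k j => l (k, j).
have Qcvg i : i \in S -> partition_cvg (fun r => Q (tau r) i) P.
  move=> iS k j; apply: Un_cv_near (lP (k, j)) => r.
  have [_ _ _ _ cl] := QP (tau r); apply: Rle_trans (cl _ _ _ _ iS i0S) _.
  apply: Rinv_le_contravar; first by apply/lt_0_INR; apply/ltP.
  have [sgr _] := sgP (tau r).
  by apply/le_INR/leP; rewrite ltnS (leq_trans (taur r)).
exists P, S, (fun i k => al i k); split; [|split; [|split]] => //.
- by apply: valid_partition_lim (Qcvg i0 i0S).
- have d0 : (0 < INR (d - 1))%R by apply/lt_0_INR/ltP; rewrite subn_gt0.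
  apply: (Rmult_le_reg_r _ _ _ d0); rewrite /Rdiv Rmult_assoc Rinv_l; last by Lra.lra.
  by rewrite Rmult_1_r -mult_INR; apply/le_INR/leP; rewrite multE mulnC.
- move=> i iS; apply: closed_pref (Qcvg i iS) _ => // r.
  by have [_ _ _ Hp _] := QP (tau r); apply: Hp.
Qed.
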